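(* Let $\bar{\mathcal Q}$ and $\bar{\mathcal R}$ denote the results computed in floating-point arithmetic by the algorithm BCGSI+A-2S applied to $\mathcal X\in\mathbb R^{m\times ps}$ with intraorthogonalization routine $\mathrm{IO}_A$. Assume that for all $X\in\mathbb R^{m\times s}$ with $\kappa(X)\le\kappa(\mathcal X)$, the following hold for the computed $[\bar Q,\bar R]=\mathrm{IO}_A(X)$: $$X+\Delta X=\bar Q\bar R,\quad \|\Delta X\|\le O(\varepsilon)\|X\|,\qquad \|I-\bar Q^T\bar Q\|\le O(\varepsilon)\,\kappa^{\alpha_A}(X).$$ If $\alpha_A\le2$ and $O(\varepsilon)\,\kappa^{3}(\mathcal X)\le\frac12$, then $$\mathcal X+\Delta\mathcal X=\bar{\mathcal Q}\bar{\mathcal R},\quad\|\Delta\mathcal X\|\le O(\varepsilon)\|\mathcal X\|,$$ and $$\|I-\bar{\mathcal Q}^T\bar{\mathcal Q}\|\le O(\varepsilon)\,\kappa^2(\mathcal X).$$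
   Context: Conventions. $m,s,p$ are positive integers with $m\ge ps$; $\mathcal X=[X_1\ X_2\ \cdots\ X_p]\in\mathbb R^{m\times ps}$ with block vectors $X_k\in\mathbb R^{m\times s}$. $\|\cdot\|$ is the induced 2-norm and $\kappa(\cdot)$ is the 2-norm condition number (ratio of largest to smallest singular value); $\kappa^{\alpha}(X)=(\kappa(X))^\alpha$, with nonnegative real exponents. Computations are carried out in floating-point arithmetic (standard model) with unit roundoff $\varepsilon$, and bars denote computed quantities; batching matrix products is assumed to introduce only $O(\varepsilon)$ errors, as for ordinary matrix products. $O(\varepsilon)$ denotes a quantity bounded by $c\,\varepsilon$, where $c$ depends only on the dimensions $m,s,p$ and may differ at each occurrence; a hypothesis involving $O(\varepsilon)$ means that it holds with a suitable (sufficiently large) such constant. An intraorthogonalization routine $\mathrm{IO}_A$ takes $X\in\mathbb R^{m\times s}$ and returns $[Q,R]$, where in exact arithmetic $X=QR$, $Q\in\mathbb R^{m\times s}$, $Q^TQ=I$, and $R\in\mathbb R^{s\times s}$ is upper triangular. $\mathrm{chol}(A)$ returns the upper triangular Cholesky factor $Y$ with $A=Y^TY$. Notation. $\mathcal Q_k=[Q_1\ \cdots\ Q_k]$; $\mathcal R=(R_{ij})$, $\mathcal S=(S_{ij})$, $\mathcal Y=(Y_{ij})$ have $s\times s$ blocks; a subscript $1{:}k-1,k$ denotes the block column with block rows $1,\dots,k-1$ and block column $k$. Algorithm BCGSI+A-2S($\mathcal X,\mathrm{IO}_A$): $[Q_1,R_{11}]=\mathrm{IO}_A(X_1)$. For $k=2,\dots,p$: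 $\mathcal S_{1:k-1,k}=\mathcal Q_{k-1}^TX_k$; $V_k=X_k-\mathcal Q_{k-1}\mathcal S_{1:k-1,k}$; $\begin{bmatrix}\mathcal Y_{1:k-1,k}\\ \Omega_k\end{bmatrix}=[\mathcal Q_{k-1}\ V_k]^TV_k$; $Y_{kk}=\mathrm{chol}(\Omega_k-\mathcal Y_{1:k-1,k}^T\mathcal Y_{1:k-1,k})$; $Q_k=(V_k-\mathcal Q_{k-1}\mathcal Y_{1:k-1,k})Y_{kk}^{-1}$; $\mathcal R_{1:k-1,k}=\mathcal S_{1:k-1,k}+\mathcal Y_{1:k-1,k}$; $R_{kk}=Y_{kk}$. Return $\mathcal Q=[Q_1,\dots,Q_p]$ and $\mathcal R=(R_{ij})$. The multiplication by $Y_{kk}^{-1}$ is computed by triangular solves. *)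

(* Defs.v *)
(* MathComp / MathComp-Analysis, over an arbitrary realType *)
From mathcomp Require Import all_boot all_order all_algebra.
From mathcomp Require Import all_classical all_reals all_analysis.

Set Implicit Arguments.
Unset Strict Implicit.
Unset Printing Implicit Defensive.

Import Order.TTheory GRing.Theory Num.Theory.

Local Open Scope classical_set_scope.
Local Open Scope ring_scope.

Definition vnorm (R : realType) (n : nat) (x : 'cV[R]_n) : R :=
  Num.sqrt (\sum_i x i 0 ^+ 2).

Definition mxnorm2 (R : realType) (m n : nat) (A : 'M[R]_(m, n)) : R :=
  sup [set vnorm (A *m x) | x in [set x : 'cV[R]_n | vnorm x <= 1]].

(* Singular values of a matrix with at least as many rows as columns: there are
   then n of them, and 0 is one exactly when the columns are dependent. *)
Definition singvals (R : realType) (m n : nat) (A : 'M[R]_(m, n)) : set R :=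
  [set t | 0 <= t /\ eigenvalue (A^T *m A) (t ^+ 2)].

(* Extended-real valued: without the case distinction, x / 0 = 0 would give a
   rank-deficient matrix the condition number 0 instead of +oo. *)
Definition kappa (R : realType) (m n : nat) (A : 'M[R]_(m, n)) : \bar R :=
  if inf (singvals A) == 0 then +oo%E
  else (sup (singvals A) / inf (singvals A))%:E.

(* Standard model with unit roundoff e: y is an admissible floating-point value
   of an elementary operation with exact value x. Working with this relation
   amounts to quantifying over all arithmetics that satisfy the model. *)
Definition fl (R : realType) (e x y : R) : Prop :=
  exists2 d : R, `|d| <= e & y = x * (1 + d).

(* y is a computed sum of the nonempty sequence s, for some order and some
   parenthesization of the additions. *)
Inductive fl_sum (R : realType) (e : R) : seq R -> R -> Prop :=
| fl_sum1 x : fl_sum e [:: x] x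
| fl_sumD s1 s2 s x1 x2 y :
    fl_sum e s1 x1 -> fl_sum e s2 x2 -> fl e (x1 + x2) y ->
    perm_eq s (s1 ++ s2) -> fl_sum e s y.

(* y is a computed value of \sum_(x <- s) x + \sum_(k | P k) u k * v k. Changes
   of sign are exact, so subtracted products are obtained by negating u. *)
Definition fl_acc (R : realType) (e : R) (s : seq R) (n : nat) (P : pred 'I_n)
    (u v : 'I_n -> R) (y : R) : Prop :=
  exists2 t : 'I_n -> R, (forall k, fl e (u k * v k) (t k)) &
    fl_sum e (s ++ [seq t k | k <- enum 'I_n & P k]) y.

Section MatrixKernels.
Variables (R : realType) (e : R).

(* C is a computed A *m B. As the order of summation is free in every entry,
   this covers blocked and batched products. *)
Definition fl_mulmx m n q (A : 'M[R]_(m, n)) (B : 'M[R]_(n, q))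
    (C : 'M[R]_(m, q)) : Prop :=
  forall i j, fl_acc e [::] predT (fun k => A i k) (fun k => B k j) (C i j).

(* C is a computed X - A *m B, including the evaluation order in which the
   product is formed first. *)
Definition fl_submulmx m n q (X : 'M[R]_(m, q)) (A : 'M[R]_(m, n))
    (B : 'M[R]_(n, q)) (C : 'M[R]_(m, q)) : Prop :=
  forall i j,
    fl_acc e [:: X i j] predT (fun k => - A i k) (fun k => B k j) (C i j).

Definition fl_addmx m n (A B C : 'M[R]_(m, n)) : Prop :=
  forall i j, fl e (A i j + B i j) (C i j).

(* Y is a computed upper triangular Cholesky factor, A = Y^T *m Y; only the
   upper triangle of A is read. The standard model does not say anything about
   the square root of a negative number or about division by zero: the outcome
   of such an operation is left arbitrary, so breakdown is not excluded here. *)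
Definition fl_chol n (A Y : 'M[R]_n) : Prop :=
  (forall i j : 'I_n, (j < i)%N -> Y i j = 0) /\
  (forall i j : 'I_n, (i <= j)%N ->
     exists2 t : R,
       fl_acc e [:: A i j] [pred k : 'I_n | (k < i)%N]
         (fun k => - Y k i) (fun k => Y k j) t &
       if i == j then 0 <= t -> fl e (Num.sqrt t) (Y i i)
       else Y i i != 0 -> fl e (t / Y i i) (Y i j)).

(* Q is a computed W *m invmx Y for an upper triangular Y, by substitution in
   every row of Q *m Y = W; division by zero is treated as in fl_chol. *)
Definition fl_trsolve m n (W : 'M[R]_(m, n)) (Y : 'M[R]_n)
    (Q : 'M[R]_(m, n)) : Prop :=
  forall (i : 'I_m) (j : 'I_n),
    exists2 t : R,
      fl_acc e [:: W i j] [pred k : 'I_n | (k < j)%N]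
        (fun k => - Q i k) (fun k => Y k j) t &
      Y j j != 0 -> fl e (t / Y j j) (Q i j).

(* One pass k >= 2 of the loop: Qp = [Q_1 ... Q_(k-1)], and (Rp, Rkk) is the
   k-th block column of the triangular factor down to the diagonal. *)
Definition bcgsia2s_step m r s (Qp : 'M[R]_(m, r)) (X Q : 'M[R]_(m, s))
    (Rp : 'M[R]_(r, s)) (Rkk : 'M[R]_s) : Prop :=
  exists (S : 'M[R]_(r, s)) (V : 'M[R]_(m, s)) (Y : 'M[R]_(r, s))
         (Omega D : 'M[R]_s) (W : 'M[R]_(m, s)),
  [/\ fl_mulmx Qp^T X S,
      fl_submulmx X Qp S V,
      fl_mulmx (row_mx Qp V)^T V (col_mx Y Omega),
      fl_submulmx Omega Y^T Y D &
      [/\ fl_chol D Rkk,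
          fl_submulmx V Qp Y W,
          fl_trsolve W Rkk Q &
          fl_addmx S Y Rp]].

End MatrixKernels.

(* Real m x ps matrices have p block columns of width s; the library's block
   operations give their width the form \sum_(k < p) s. *)
Notation blockcols p s := (\sum_(k < p) s)%N (only parsing).

Section Algorithm.
Variables (R : realType) (m s p : nat).

Definition blkcol (A : 'M[R]_(m, blockcols p s)) (k : 'I_p) : 'M[R]_(m, s) :=
  @submxrow R p (fun=> s) m A k.

Definition blk (A : 'M[R]_(blockcols p s)) (i j : 'I_p) : 'M[R]_s :=
  @submxblock R p p (fun=> s) (fun=> s) A i j.

Definition below (k : 'I_p) (i : 'I_k) : 'I_p :=
  widen_ord (ltnW (ltn_ord k)) i.

(* (Q, T) is a possible result of BCGSI+A-2S(X, IO) in floating-point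
   arithmetic with unit roundoff e; IO X is the pair [Q, R] computed by the
   intraorthogonalization routine. Blocks are numbered from 0. *)
Definition bcgsia2s (e : R) (IO : 'M[R]_(m, s) -> 'M[R]_(m, s) * 'M[R]_s)
    (X Q : 'M[R]_(m, blockcols p s)) (T : 'M[R]_(blockcols p s)) : Prop :=
  [/\ forall k : 'I_p, val k = 0%N -> IO (blkcol X k) = (blkcol Q k, blk T k k),
      forall k : 'I_p, (0 < k)%N ->
        bcgsia2s_step e (\mxrow_(i < k) blkcol Q (below i)) (blkcol X k)
          (blkcol Q k) (\mxcol_(i < k) blk T (below i) k) (blk T k k) &
      forall i j : 'I_p, (j < i)%N -> blk T i j = 0].

End Algorithm.

(* The assumption on the intraorthogonalization routine, for inputs of
   condition number at most K; c1 and c2 are the two O(e)-constants. *)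
Definition io_accurate (R : realType) (m s : nat) (e c1 c2 alpha : R)
    (IO : 'M[R]_(m, s) -> 'M[R]_(m, s) * 'M[R]_s) (K : \bar R) : Prop :=
  forall X : 'M[R]_(m, s), (kappa X <= K)%E ->
    (exists2 dX : 'M[R]_(m, s), X + dX = (IO X).1 *m (IO X).2 &
       mxnorm2 dX <= c1 * e * mxnorm2 X) /\
    ((mxnorm2 (1%:M - (IO X).1^T *m (IO X).1))%:E
       <= (c2 * e)%:E * kappa X `^ alpha)%E.

(* Main.v *)
(** One loop pass is a Gram-Schmidt projection [V = X - Qp S], followed by a
    Pythagorean Cholesky factorization of [V^T V - Y^T Y] with [Y = Qp^T V].
    As [Qp = (Xp + dXp) Tp^-1], the columns of [Qp S] are nearly in the range of
    the previous columns, hence the smallest singular value of [V] is at least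
    half of that of the whole matrix [X].  On the other hand
    [Qp^T V = (I - Qp^T Qp) S + O(e)] is [O(e kappa^2) |X|], so that [Y] is
    small compared with the smallest singular value of [V] as soon as
    [e kappa^3] is small: the Cholesky factorization then succeeds and its
    factor [T] satisfies [|V y| <= 2 |T y|].  Multiplying the identities for
    [T^T (Q^T Q - I) T] and [Qp^T Q T], whose right-hand sides only contain
    rounding errors and multiples of [I - Qp^T Qp], by [T^-1] yields the loss of
    orthogonality [O(e kappa^2)].

    Constants are handled by a domination relation along a filter: all matrices
    are functions of an index [i] ranging over the possible runs, and
    [e i * k i ^+ 3] tends to 0.  Matrices are measured by the sum of the
    absolute values of their entries, which is submultiplicative and, up to
    factors depending on the dimensions, equivalent to the 2-norm. *)

Require Import Defs.
From mathcomp Require Import all_boot all_order all_algebra.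
From mathcomp Require Import all_classical all_reals all_analysis.
From mathcomp Require Import ring lra.

Set Implicit Arguments.
Unset Strict Implicit.
Unset Printing Implicit Defensive.

Import Order.TTheory GRing.Theory Num.Theory.
Local Open Scope ring_scope.

(** * Entrywise norm and quadratic forms *)

Section EntrywiseNorm.
Variable R : realType.

Definition onorm m n (A : 'M[R]_(m, n)) : R := \sum_i \sum_j `|A i j|.

Definition sqn n (y : 'cV[R]_n) : R := \sum_i y i 0 ^+ 2.

Definition bil m n (M : 'M[R]_(m, n)) (u : 'cV[R]_m) (v : 'cV[R]_n) : R :=
  (u^T *m M *m v) 0 0.

Lemma onorm_ge0 m n (A : 'M[R]_(m, n)) : 0 <= onorm A.
Proof. by apply: sumr_ge0 => i _; apply: sumr_ge0. Qed.
Hint Resolve onorm_ge0 : core.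

Lemma sqn_ge0 n (y : 'cV[R]_n) : 0 <= sqn y.
Proof. by apply: sumr_ge0 => i _; rewrite sqr_ge0. Qed.
Hint Resolve sqn_ge0 : core.

Lemma ler_entry_onorm m n (A : 'M[R]_(m, n)) i j : `|A i j| <= onorm A.
Proof.
rewrite /onorm (bigD1 i) //= (bigD1 j) //= -addrA lerDl.
by rewrite addr_ge0 //; apply: sumr_ge0 => // k _; apply: sumr_ge0.
Qed.

Lemma onorm_le m n (A : 'M[R]_(m, n)) c :
  (forall i j, `|A i j| <= c) -> onorm A <= (m * n)%:R * c.
Proof.
move=> h; apply: (@le_trans _ _ (\sum_(i < m) \sum_(j < n) c)).
  by apply: ler_sum => i _; apply: ler_sum => j _; exact: h.
rewrite big_const_ord iter_addr_0 sumr_const card_ord -mulrnA.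
by rewrite mulr_natl mulnC.
Qed.

Lemma onorm_mono m n (A : 'M[R]_(m, n)) (f : 'I_m -> 'I_n -> R) :
  (forall i j, `|A i j| <= f i j) -> onorm A <= \sum_i \sum_j f i j.
Proof. by move=> h; apply: ler_sum => i _; apply: ler_sum => j _; exact: h. Qed.

Lemma onormD m n (A B : 'M[R]_(m, n)) : onorm (A + B) <= onorm A + onorm B.
Proof.
apply: (le_trans (onorm_mono (f := fun i j => `|A i j| + `|B i j|) _)).
  by move=> i j; rewrite mxE ler_normD.
by rewrite -big_split /=; apply: ler_sum => i _; rewrite big_split.
Qed.

Lemma onormN m n (A : 'M[R]_(m, n)) : onorm (- A) = onorm A.
Proof.
by apply: eq_bigr => i _; apply: eq_bigr => j _; rewrite mxE normrN.
Qed.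

Lemma onorm_distC m n (A B : 'M[R]_(m, n)) : onorm (A - B) = onorm (B - A).
Proof. by rewrite -onormN opprB. Qed.

Lemma onormT m n (A : 'M[R]_(m, n)) : onorm A^T = onorm A.
Proof.
rewrite /onorm exchange_big; apply: eq_bigr => i _.
by apply: eq_bigr => j _; rewrite mxE.
Qed.

(** Summing over [k] last factors the terms into a column sum of [A] times a row sum of [B], and the
    latter is at most [onorm B]. Rounding errors of products are bounded by the same sum. *)
Lemma absM_sum_le m n q (A : 'M[R]_(m, n)) (B : 'M[R]_(n, q)) :
  \sum_i \sum_j \sum_k `|A i k| * `|B k j| <= onorm A * onorm B.
Proof.
have -> : \sum_i \sum_j \sum_k `|A i k| * `|B k j|
    = \sum_k (\sum_i `|A i k|) * (\sum_j `|B k j|).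
  rewrite [RHS](eq_bigr (fun k => \sum_i \sum_j `|A i k| * `|B k j|)); last first.
    move=> k _; rewrite mulr_suml; apply: eq_bigr => i _; by rewrite mulr_sumr.
  rewrite [RHS]exchange_big; apply: eq_bigr => i _ /=.
  by rewrite exchange_big.
rewrite -[onorm A]onormT [onorm A^T]/onorm.
rewrite mulr_suml; apply: ler_sum => k _.
have -> : \sum_j `|A^T k j| = \sum_i `|A i k| by apply: eq_bigr => i _; rewrite mxE.
apply: ler_wpM2l; first exact: sumr_ge0.
rewrite /onorm (bigD1 k) //= lerDl; apply: sumr_ge0 => i _; exact: sumr_ge0.
Qed.

Lemma onormM m n q (A : 'M[R]_(m, n)) (B : 'M[R]_(n, q)) :
  onorm (A *m B) <= onorm A * onorm B.
Proof.
apply: le_trans (absM_sum_le A B); apply: onorm_mono => i j.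
rewrite mxE; apply: (le_trans (ler_norm_sum _ _ _)).
by apply: ler_sum => k _; rewrite normrM.
Qed.

Lemma bilE m n (M : 'M[R]_(m, n)) u v :
  bil M u v = \sum_i \sum_j u i 0 * v j 0 * M i j.
Proof.
rewrite /bil mxE exchange_big /=; apply: eq_bigr => j _.
rewrite mxE mulr_suml; apply: eq_bigr => i _; rewrite mxE; ring.
Qed.

Lemma bilDl m n (M P : 'M[R]_(m, n)) u v :
  bil (M + P) u v = bil M u v + bil P u v.
Proof. by rewrite /bil mulmxDr mulmxDl mxE. Qed.

Lemma bilBl m n (M P : 'M[R]_(m, n)) u v :
  bil (M - P) u v = bil M u v - bil P u v.
Proof. by rewrite /bil mulmxBr mulmxBl !mxE. Qed.

Lemma bilC n (M : 'M[R]_n) u v : M^T = M -> bil M u v = bil M v u.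
Proof.
move=> sM; rewrite !bilE exchange_big; apply: eq_bigr => i _.
by apply: eq_bigr => j _; rewrite -[in LHS]sM mxE; ring.
Qed.

Lemma sqnE n (y : 'cV[R]_n) : sqn y = (y^T *m y) 0 0.
Proof. by rewrite mxE; apply: eq_bigr => i _; rewrite mxE expr2. Qed.

Lemma sqn_mulmx m n (A : 'M[R]_(m, n)) y : sqn (A *m y) = bil (A^T *m A) y y.
Proof. by rewrite sqnE /bil trmx_mul !mulmxA. Qed.

Lemma ler_sqr_sqn n (y : 'cV[R]_n) i : y i 0 ^+ 2 <= sqn y.
Proof.
rewrite /sqn (bigD1 i) //= lerDl; apply: sumr_ge0 => j _; exact: sqr_ge0.
Qed.

Lemma sqn_eq0 n (y : 'cV[R]_n) : sqn y = 0 -> y = 0.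
Proof.
move=> h; apply/colP => i; rewrite mxE; apply/eqP.
by rewrite -sqrf_eq0 eq_le sqr_ge0 andbT -h ler_sqr_sqn.
Qed.

Lemma sqnD n (u v : 'cV[R]_n) : sqn (u + v) <= 2 * sqn u + 2 * sqn v.
Proof.
rewrite /sqn !mulr_sumr -big_split /=; apply: ler_sum => i _; rewrite mxE.
have := sqr_ge0 (u i 0 - v i 0); lra.
Qed.

Lemma sqnN n (u : 'cV[R]_n) : sqn (- u) = sqn u.
Proof. by apply: eq_bigr => i _; rewrite mxE sqrrN. Qed.

Lemma sqnZ n a (u : 'cV[R]_n) : sqn (a *: u) = a ^+ 2 * sqn u.
Proof. by rewrite /sqn mulr_sumr; apply: eq_bigr => i _; rewrite mxE exprMn. Qed.

Lemma bil_le n (M : 'M[R]_n) y : `|bil M y y| <= onorm M * sqn y.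
Proof.
rewrite bilE /onorm mulr_suml; apply: (le_trans (ler_norm_sum _ _ _)).
apply: ler_sum => i _; rewrite mulr_suml; apply: (le_trans (ler_norm_sum _ _ _)).
apply: ler_sum => j _; rewrite normrM mulrC; apply: ler_wpM2l => //.
(* Both signs of [y i * y j] are at most half the sum of the two squares, hence at most [sqn y]. *)
have h k := ler_sqr_sqn y k.
have hi := h i; have hj := h j; rewrite ler_norml; apply/andP; split.
  have := sqr_ge0 (y i 0 + y j 0); lra.
have := sqr_ge0 (y i 0 - y j 0); lra.
Qed.

Lemma sqn_mulmx_le m n (A : 'M[R]_(m, n)) y :
  sqn (A *m y) <= onorm A ^+ 2 * sqn y.
Proof.
rewrite sqn_mulmx; apply: (le_trans (ler_norm _)); apply: (le_trans (bil_le _ _)).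
apply: ler_wpM2r => //; rewrite expr2 -[X in X * _]onormT; exact: onormM.
Qed.

Lemma sqn_delta n (j : 'I_n) : sqn (delta_mx j 0 : 'cV[R]_n) = 1.
Proof.
rewrite /sqn (bigD1 j) //= mxE !eqxx expr1n big1 ?addr0 // => i ij.
by rewrite mxE (negbTE ij) expr0n.
Qed.

Lemma sqr_entry_le m n (A : 'M[R]_(m, n)) c i j :
  (forall y, sqn (A *m y) <= c * sqn y) -> A i j ^+ 2 <= c.
Proof.
move=> h; have := h (delta_mx j 0); rewrite sqn_delta mulr1 -colE.
by apply: le_trans; have := ler_sqr_sqn (col j A) i; rewrite mxE.
Qed.

Lemma ler_norm_sqr (a b : R) : 0 <= b -> a ^+ 2 <= b ^+ 2 -> `|a| <= b.
Proof. by move=> b0; rewrite -[a ^+ 2]real_normK ?num_real // ler_pXn2r ?nnegrE. Qed.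

Lemma onorm_le_gain m n (A : 'M[R]_(m, n)) c : 0 <= c ->
  (forall y, sqn (A *m y) <= c ^+ 2 * sqn y) -> onorm A <= (m * n)%:R * c.
Proof.
move=> c0 h; apply: onorm_le => i j; apply: ler_norm_sqr => //.
exact: sqr_entry_le.
Qed.

Lemma sqr_entry_gram m n (A : 'M[R]_(m, n)) i j : A i j ^+ 2 <= (A^T *m A) j j.
Proof.
rewrite mxE (bigD1 i) //= mxE -expr2 lerDl.
by apply: sumr_ge0 => k _; rewrite mxE -expr2 sqr_ge0.
Qed.

End EntrywiseNorm.

#[local] Hint Resolve onorm_ge0 sqn_ge0 : core.

(** * Rounding errors of the matrix kernels *)

Section RoundingErrors.
Variable R : realType.
Implicit Type e : R.

Lemma fl_sum_gt0 e s (y : R) : fl_sum e s y -> (0 < size s)%N.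
Proof.
by elim=> // s1 s2 {}s x1 x2 {}y _ s1_gt0 _ _ _ /perm_size ->; rewrite size_cat addn_gt0 s1_gt0.
Qed.

(** Each summand passes through fewer than [size s] additions, whatever the parenthesization, and
    each of them contributes a factor [1 + d]. *)
Lemma fl_sum_err e s (y : R) : 0 <= e -> fl_sum e s y ->
  `|y - \sum_(x <- s) x| <= ((1 + e) ^+ size s - 1) * \sum_(x <- s) `|x|.
Proof.
move=> e0 Hs; elim: Hs => [x|s1 s2 {}s x1 x2 {}y H1 IH1 H2 IH2 [d hd ->] sE].
  by rewrite !big_seq1 subrr normr0 /= expr1 mulr_ge0 //; lra.
rewrite !(perm_big _ sE) /= !big_cat /= (perm_size sE) size_cat.
move: (fl_sum_gt0 H1) (fl_sum_gt0 H2) IH1 IH2.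
move: (size s1) (size s2) => [//|n1] [//|n2] _ _.
set S1 := \sum_(x <- s1) x; set S2 := \sum_(x <- s2) x.
set A1 := \sum_(x <- s1) `|x|; set A2 := \sum_(x <- s2) `|x|.
have hS1 : `|S1| <= A1 by exact: ler_norm_sum.
have hS2 : `|S2| <= A2 by exact: ler_norm_sum.
(* Neither part is empty, so [p], one power below the target, covers both of them; the last addition
   supplies the missing factor. *)
set p := (1 + e) ^+ (n1 + n2).+1.
have h1 : (1 + e) ^+ n1.+1 <= p by rewrite ler_weXn2l ?lerDl // ltnS leq_addr.
have h2 : (1 + e) ^+ n2.+1 <= p by rewrite ler_weXn2l ?lerDl // ltnS leq_addl.
have -> : (1 + e) ^+ (n1.+1 + n2.+1) = p * (1 + e) by rewrite addSn addnS exprSr.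
move=> IH1 IH2.
have A1_ge0 : 0 <= A1 by exact: le_trans hS1.
have A2_ge0 : 0 <= A2 by exact: le_trans hS2.
have {h1}IH1 : `|x1 - S1| <= (p - 1) * A1.
  by apply: (le_trans IH1); apply: ler_wpM2r => //; rewrite lerD2r.
have {h2}IH2 : `|x2 - S2| <= (p - 1) * A2.
  by apply: (le_trans IH2); apply: ler_wpM2r => //; rewrite lerD2r.
have hx : `|x1 + x2 - (S1 + S2)| <= (p - 1) * (A1 + A2).
  have -> : x1 + x2 - (S1 + S2) = (x1 - S1) + (x2 - S2) by ring.
  by apply: (le_trans (ler_normD _ _)); lra.
have hy : `|x1 + x2| <= p * (A1 + A2).
  have -> : x1 + x2 = (x1 + x2 - (S1 + S2)) + (S1 + S2) by ring.
  apply: (le_trans (ler_normD _ _)); have := ler_normD S1 S2; lra.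
have -> : (x1 + x2) * (1 + d) - (S1 + S2) = x1 + x2 - (S1 + S2) + (x1 + x2) * d by ring.
apply: (le_trans (ler_normD _ _)); rewrite normrM.
have : `|x1 + x2| * `|d| <= p * (A1 + A2) * e by apply: ler_pM.
lra.
Qed.

Lemma expr1D_le e n : 0 <= e -> e <= 1 -> (1 + e) ^+ n - 1 <= 2 ^+ n * e.
Proof.
move=> e0 e1; elim: n => [|n IH]; first by rewrite !expr0; lra.
have : (1 + e) ^+ n <= 2 ^+ n by rewrite lerXn2r ?nnegrE; lra.
move=> /(ler_wpM2r e0); rewrite !exprS; lra.
Qed.

(** The exponent exceeds [size s + n] by one to pay for the rounding of the products before they are
    summed. *)
Lemma fl_acc_err e s n (P : pred 'I_n) (u v : 'I_n -> R) y :
  0 <= e -> e <= 1 -> fl_acc e s P u v y ->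
  `|y - (\sum_(x <- s) x + \sum_(k | P k) u k * v k)|
    <= 2 ^+ (size s + n).+1 * e * (\sum_(x <- s) `|x| + \sum_(k | P k) `|u k * v k|).
Proof.
move=> e0 e1 [t ht] /(fl_sum_err e0); rewrite !big_cat /= !big_map.
rewrite !big_filter !big_enum_cond /= size_cat size_map size_filter.
set c := count _ _; have cn : (c <= n)%N by rewrite (leq_trans (count_size _ _)) ?size_enum_ord.
set S := \sum_(x <- s) x; set T := \sum_(k | P k) t k.
set U := \sum_(k | P k) u k * v k; set AS := \sum_(x <- s) `|x|.
set AT := \sum_(k | P k) `|t k|; set AU := \sum_(k | P k) `|u k * v k|.
have AS0 : 0 <= AS by exact: sumr_ge0.
have AU0 : 0 <= AU by exact: sumr_ge0.
have hTU : `|T - U| <= e * AU.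
  rewrite /T /U -sumrB /AU mulr_sumr; apply: (le_trans (ler_norm_sum _ _ _)).
  apply: ler_sum => k _; have [d hd ->] := ht k.
  have -> : u k * v k * (1 + d) - u k * v k = d * (u k * v k) by ring.
  by rewrite normrM; apply: ler_wpM2r.
have hAT : AT <= (1 + e) * AU.
  rewrite /AT /AU mulr_sumr; apply: ler_sum => k _; have [d hd ->] := ht k.
  rewrite normrM mulrC; apply: ler_wpM2r => //.
  by apply: (le_trans (ler_normD _ _)); rewrite normr1 lerD2l.
set q := (1 + e) ^+ (size s + c) => hy.
have q1 : 1 <= q by rewrite exprn_ege1 // lerDl.
have qn : q * (1 + e) - 1 <= 2 ^+ (size s + n).+1 * e.
  apply: le_trans (expr1D_le _ e0 e1); rewrite lerD2r exprSr.
  by apply: ler_wpM2r; [lra | rewrite ler_weXn2l ?lerDl // leq_add2l].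
have -> : y - (S + U) = (y - (S + T)) + (T - U) by ring.
apply: (le_trans (ler_normD _ _)).
apply: (@le_trans _ _ ((q * (1 + e) - 1) * (AS + AU))); last first.
  by apply: ler_wpM2r => //; exact: addr_ge0.
have : (q - 1) * (AS + AT) <= (q - 1) * (AS + (1 + e) * AU).
  by apply: ler_wpM2l; [lra | rewrite lerD2l].
have : 0 <= q * e * AS by rewrite !mulr_ge0 //; lra.
lra.
Qed.

Lemma fl_mulmx_err e m n q (A : 'M[R]_(m, n)) (B : 'M[R]_(n, q)) C :
  0 <= e -> e <= 1 -> fl_mulmx e A B C ->
  onorm (C - A *m B) <= 2 ^+ n.+1 * e * (onorm A * onorm B).
Proof.
move=> e0 e1 h; have c0 : 0 <= 2 ^+ n.+1 * e by rewrite mulr_ge0 ?exprn_ge0.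
apply: le_trans (ler_wpM2l c0 (absM_sum_le A B)).
apply: (le_trans (onorm_mono (f := fun i j =>
  2 ^+ n.+1 * e * \sum_k `|A i k| * `|B k j|) _)); last first.
  by rewrite mulr_sumr; apply: ler_sum => i _; rewrite mulr_sumr.
move=> i j; rewrite !mxE; have := fl_acc_err e0 e1 (h i j).
rewrite !big_nil !add0r; under [X in _ * X]eq_bigr do rewrite normrM.
by [].
Qed.

Lemma fl_submulmx_err e m n q (X : 'M[R]_(m, q)) (A : 'M[R]_(m, n)) (B : 'M[R]_(n, q)) C :
  0 <= e -> e <= 1 -> fl_submulmx e X A B C ->
  onorm (C - (X - A *m B)) <= 2 ^+ n.+2 * e * (onorm X + onorm A * onorm B).
Proof.
move=> e0 e1 h; have c0 : 0 <= 2 ^+ n.+2 * e by rewrite mulr_ge0 ?exprn_ge0.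
have h2 : \sum_i \sum_j (`|X i j| + \sum_k `|A i k| * `|B k j|) <= onorm X + onorm A * onorm B.
  rewrite (eq_bigr (fun i => \sum_j `|X i j| + \sum_j \sum_k `|A i k| * `|B k j|)).
    by rewrite big_split lerD2l; exact: absM_sum_le.
  by move=> i _; rewrite big_split.
apply: le_trans (ler_wpM2l c0 h2).
apply: (le_trans (onorm_mono (f := fun i j =>
  2 ^+ n.+2 * e * (`|X i j| + \sum_k `|A i k| * `|B k j|)) _)); last first.
  by rewrite mulr_sumr; apply: ler_sum => i _; rewrite mulr_sumr.
move=> i j; rewrite !mxE; have := fl_acc_err e0 e1 (h i j).
rewrite !big_seq1; under [X in _ * (_ + X)]eq_bigr do rewrite normrM normrN.
by under [X in `|_ - (_ + X)|]eq_bigr do rewrite mulNr; rewrite sumrN.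
Qed.

Lemma fl_addmx_err e m n (A B C : 'M[R]_(m, n)) :
  0 <= e -> fl_addmx e A B C -> onorm (C - (A + B)) <= e * (onorm A + onorm B).
Proof.
move=> e0 h; apply: le_trans (ler_wpM2l e0 (onormD A B)).
apply: (le_trans (onorm_mono (f := fun i j => e * `|(A + B) i j|) _)).
  move=> i j; have [d hd] := h i j; rewrite !mxE => ->.
  have -> : (A i j + B i j) * (1 + d) - (A i j + B i j) = d * (A i j + B i j) by ring.
  by rewrite normrM; apply: ler_wpM2r.
by rewrite mulr_sumr; apply: ler_sum => i _; rewrite mulr_sumr.
Qed.

(** Products are specified entry by entry, so a batched product is a pair of separate ones. *)
Lemma fl_mulmx_row e m n1 n2 q (A : 'M[R]_(m, n1)) (B : 'M[R]_(m, n2))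
    (V : 'M[R]_(m, q)) Y Z :
  fl_mulmx e (row_mx A B)^T V (col_mx Y Z) ->
  fl_mulmx e A^T V Y /\ fl_mulmx e B^T V Z.
Proof.
move=> h; split=> i j.
  have := h (lshift _ i) j; rewrite col_mxEu; congr (fl_acc _ _ _ _ _ _).
  by apply/funext => k; rewrite !mxE (unsplitK (inl _)).
have := h (rshift _ i) j; rewrite col_mxEd; congr (fl_acc _ _ _ _ _ _).
by apply/funext => k; rewrite !mxE (unsplitK (inr _)).
Qed.

(** Multiplying the rounded quotient by its divisor gives back [t * (1 + f)], so the bound does not
    depend on the size of [d]. *)
Lemma fl_div_err e a b c z d t y : 0 <= e -> e <= 1 -> 0 <= c -> 0 <= a ->
  `|t - z| <= c * e * a -> `|z| <= a -> d != 0 -> fl e (t / d) y -> b = y * d ->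
  `|b - z| <= (2 * c + 1) * e * a.
Proof.
move=> e0 e1 c0 a0 htz hz d0 [f hf ->] ->.
have -> : t / d * (1 + f) * d - z = (t - z) + t * f by field.
apply: (le_trans (ler_normD _ _)); rewrite normrM.
have ht : `|t| <= (c * e + 1) * a.
  have -> : t = (t - z) + z by ring.
  by apply: (le_trans (ler_normD _ _)); lra.
have : `|t| * `|f| <= (c * e + 1) * a * e by apply: ler_pM.
have : c * e * a * e <= c * e * a.
  by rewrite ler_piMr // !mulr_ge0.
lra.
Qed.

(** The error is stated as a residual, so that the conditioning of [Y] does not enter; the price is
    the norm of the computed [Q] on the right. *)
Lemma fl_trsolve_err e m n (W : 'M[R]_(m, n)) (Y : 'M[R]_n) Q :
  0 <= e -> e <= 1 -> (forall i j : 'I_n, (j < i)%N -> Y i j = 0) ->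
  (forall j, Y j j != 0) -> fl_trsolve e W Y Q ->
  onorm (Q *m Y - W) <= (2 ^+ n.+3 + 1) * e * (onorm W + onorm Q * onorm Y).
Proof.
move=> e0 e1 Yt Yn0 h.
have c0 : 0 <= (2 ^+ n.+3 + 1) * e by rewrite mulr_ge0 // addr_ge0 ?exprn_ge0.
have h2 : \sum_i \sum_j (`|W i j| + \sum_k `|Q i k| * `|Y k j|) <= onorm W + onorm Q * onorm Y.
  rewrite (eq_bigr (fun i => \sum_j `|W i j| + \sum_j \sum_k `|Q i k| * `|Y k j|)).
    by rewrite big_split lerD2l; exact: absM_sum_le.
  by move=> i _; rewrite big_split.
apply: le_trans (ler_wpM2l c0 h2).
apply: (le_trans (onorm_mono (f := fun i j =>
  (2 ^+ n.+3 + 1) * e * (`|W i j| + \sum_k `|Q i k| * `|Y k j|)) _)); last first.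
  by rewrite mulr_sumr; apply: ler_sum => i _; rewrite mulr_sumr.
move=> i j; have [t /(fl_acc_err e0 e1)] := h i j.
rewrite !big_seq1 /= => ht /(_ (Yn0 j)) hq.
set a := (`|W i j| + _).
set z := (W i j + _) in ht.
set a' := (`|W i j| + _) in ht.
have a'a : a' <= a.
  rewrite /a' /a lerD2l [leRHS](bigID [pred k : 'I_n | (k < j)%N]) /=.
  under eq_bigr do rewrite normrM normrN.
  by rewrite lerDl; apply: sumr_ge0 => k _; rewrite mulr_ge0.
have za : `|z| <= a.
  apply: le_trans a'a; rewrite /z /a'; apply: (le_trans (ler_normD _ _)).
  by rewrite lerD2l; exact: ler_norm_sum.
have -> : (Q *m Y - W) i j = Q i j * Y j j - z.
  have sumE : (Q *m Y) i j = \sum_(k : 'I_n | (k < j)%N) Q i k * Y k j + Q i j * Y j j.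
    rewrite mxE (bigID [pred k : 'I_n | (k < j)%N]) /=; congr (_ + _).
    rewrite (bigD1 j) ?ltnn //= big1 ?addr0 // => k /andP[].
    rewrite -leqNgt leq_eqVlt => /orP[/eqP jk|jk _].
      by move/eqP; case; apply/val_inj.
    by rewrite Yt ?mulr0.
  rewrite mxE sumE mxE /z.
  by under [X in _ - (_ + X)]eq_bigr do rewrite mulNr; rewrite sumrN; ring.
have := @fl_div_err e a _ (2 ^+ n.+2) z _ t _ e0 e1 _ _ _ za (Yn0 j) hq erefl.
rewrite -exprS; apply.
- by rewrite exprn_ge0.
- by rewrite (le_trans _ za).
- apply: (le_trans ht); rewrite add1n; apply: ler_wpM2l => //.
  by rewrite mulr_ge0 ?exprn_ge0.
Qed.

End RoundingErrors.

(** * Success and backward error of the Cholesky factorization *)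

Section Cholesky.
Variable R : realType.
Implicit Type e : R.

(** The leading block of order [i] is triangular with nonzero diagonal, so the part of column [i]
    above the diagonal is a combination of the preceding columns. *)
Lemma leading_trig_solve n (Y : 'M[R]_n) (i : 'I_n) :
  (forall k j : 'I_n, (j < k)%N -> Y k j = 0) ->
  (forall j : 'I_n, (j < i)%N -> Y j j != 0) ->
  exists2 w : 'cV_n, forall j : 'I_n, (i <= j)%N -> w j 0 = 0 &
    forall k : 'I_n, (Y *m w) k 0 = if (k < i)%N then Y k i else 0.
Proof.
move=> Yt Yd.
(* The leading block is completed by the identity to an invertible matrix of full size. *)
pose L := \matrix_(k < n, j < n) if (k < i)%N && (j < i)%N then Y k j else (k == j)%:R.
pose r := \col_k if (k < i)%N then Y k i else 0.
have Lu : L \in unitmx.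
  rewrite -unitmx_tr unitmxE det_trig; last first.
    apply/is_trig_mxP => k j kj; rewrite !mxE.
    by case: ifP => _; rewrite ?Yt // -val_eqE /= gtn_eqF.
  rewrite unitfE prodf_seq_neq0; apply/allP => k _ /=; rewrite !mxE andbb.
  by case: ifP => [/Yd //|_]; rewrite eqxx oner_eq0.
have [w Lw] : exists w, L *m w = r by exists (invmx L *m r); rewrite mulKVmx.
have w0 (k : 'I_n) : (i <= k)%N -> w k 0 = 0.
  move=> ik; have : (L *m w) k 0 = 0 by rewrite Lw mxE ltnNge ik.
  rewrite mxE (bigD1 k) //= mxE ltnNge ik /= eqxx mul1r big1 ?addr0 // => j jk.
  by rewrite mxE ltnNge ik /= eq_sym (negbTE jk) mul0r.
exists w => // k; have [ki|ik] := ltnP k i; last first.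
  rewrite mxE big1 // => j _; have [ji|ij] := ltnP j i.
    by rewrite Yt ?mul0r // (leq_trans ji).
  by rewrite w0 ?mulr0.
have -> : Y k i = (L *m w) k 0 by rewrite Lw mxE ki.
rewrite !mxE; apply: eq_bigr => j _; rewrite mxE ki /=.
by have [//|ij] := ltnP j i; rewrite w0 ?mulr0.
Qed.

(** Squaring the rounded root gives [t * (1 + d) ^+ 2], and [d * (2 + d)] is at most [3 * e] in
    absolute value. *)
Lemma fl_sqrt_err e z a t c y : 0 <= e -> e <= 1 -> 0 <= c -> 0 <= t ->
  `|t - z| <= c * e * a -> `|z| <= a -> fl e (Num.sqrt t) y ->
  `|y ^+ 2 - z| <= (4 * c + 3) * e * a.
Proof.
move=> e0 e1 c0 t0 htz hz [d hd ->].
have a0 : 0 <= a by exact: le_trans hz.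
rewrite exprMn sqr_sqrtr //.
have -> : t * (1 + d) ^+ 2 - z = (t - z) + t * (d * (2 + d)) by ring.
apply: (le_trans (ler_normD _ _)); rewrite !normrM.
have ht : `|t| <= (c + 1) * a.
  have -> : t = (t - z) + z by ring.
  apply: (le_trans (ler_normD _ _)).
  have : c * e * a <= c * a by rewrite mulrAC ler_piMr // mulr_ge0.
  lra.
have hd2 : `|2 + d| <= 3.
  by apply: (le_trans (ler_normD _ _)); rewrite ger0_norm //; lra.
have h1 : `|d| * `|2 + d| <= e * 3 by apply: ler_pM.
have h2 : `|t| * (`|d| * `|2 + d|) <= (c + 1) * a * (e * 3).
  by apply: ler_pM => //; rewrite mulr_ge0.
lra.
Qed.

Variables (n : nat) (c g e mu nu : R) (A Y : 'M[R]_n).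
(** [c] is the constant [4 * 2 ^+ n.+2 + 3] of the square root, which also covers the division; [g]
    sums the bound [3 * c] over all entries. *)
Hypothesis cE : c = 2 ^+ n.+4 + 3.
Hypothesis gE : g = 3 * (n * n)%:R * c.
Hypotheses (e_ge0 : 0 <= e) (e_le1 : e <= 1) (A_sym : A^T = A).
(** [mu] measures the definiteness of [A] and [nu] the size of its entries; [small_nu] keeps the
    rounding errors, of order [e * nu], well below [mu]. *)
Hypothesis A_def : forall w, mu * sqn w <= bil A w w.
Hypothesis A_le : forall i j, `|A i j| <= nu.
Hypotheses (mu_gt0 : 0 < mu) (small_e : 20 * g * e <= 1).
Hypothesis small_nu : 20 * g * e * nu <= mu.
Hypothesis AY : fl_chol e A Y.

Let Yt (i j : 'I_n) : (j < i)%N -> Y i j = 0. Proof. by case: AY => + _; apply. Qed.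

Let E := Y^T *m Y - A.

Let a (j i : 'I_n) : R := `|A j i| + \sum_(k : 'I_n | (k < j)%N) `|Y k j| * `|Y k i|.

Let E_tr j l : E l j = E j l.
Proof.
have : E^T = E by rewrite /E linearB /= trmx_mul trmxK A_sym.
by move=> h; rewrite -[in LHS]h mxE.
Qed.

Let c0 : 0 <= 2 ^+ n.+2 :> R. Proof. by rewrite exprn_ge0. Qed.

Let z (j i : 'I_n) : R := A j i - \sum_(k : 'I_n | (k < j)%N) Y k j * Y k i.

Let z_le j i : `|z j i| <= a j i.
Proof.
apply: (le_trans (ler_normB _ _)); rewrite lerD2l.
by apply: (le_trans (ler_norm_sum _ _ _)); apply: ler_sum => k _; rewrite normrM.
Qed.

Let a_ge0 j i : 0 <= a j i. Proof. exact: le_trans (z_le j i). Qed.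

Let ce0 : 0 <= 2 ^+ n.+2 * e. Proof. by rewrite mulr_ge0. Qed.

(** Beyond [k = j] the terms of [Y^T *m Y] vanish by triangularity. The residual is thus the error
    of one accumulation followed by a division or a square root. *)
Let E_z (j i : 'I_n) : E j i = Y j j * Y j i - z j i.
Proof.
rewrite /E !mxE (bigID [pred k : 'I_n | (k < j)%N]) /=.
rewrite [\sum_(k : 'I_n | ~~ _) _](bigD1 j) ?ltnn //= [X in _ + (_ + X)]big1 ?addr0.
  rewrite mxE /z; under eq_bigr do rewrite mxE; ring.
move=> k /andP[]; rewrite -leqNgt leq_eqVlt => /orP[/eqP jk|jk _].
  by move/eqP; case; apply/val_inj.
by rewrite mxE Yt ?mul0r.
Qed.

Let pivot (j i : 'I_n) : (j <= i)%N -> exists2 t,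
    `|t - z j i| <= 2 ^+ n.+2 * e * a j i &
    if j == i then 0 <= t -> fl e (Num.sqrt t) (Y j j)
    else Y j j != 0 -> fl e (t / Y j j) (Y j i).
Proof.
move=> ji; have [_ /(_ j i ji)[t /(fl_acc_err e_ge0 e_le1) ht hq]] := AY.
exists t => //; move: ht; rewrite !big_seq1 add1n /z /a.
under [X in `|_ - (_ + X)|]eq_bigr do rewrite mulNr.
by under [X in _ * (_ + X)]eq_bigr do rewrite normrM normrN; rewrite sumrN.
Qed.

Let E_off (j i : 'I_n) : (j < i)%N -> Y j j != 0 -> `|E j i| <= c * e * a j i.
Proof.
move=> ji Yj; have [t ht] := pivot (ltnW ji).
rewrite -val_eqE /= ltn_eqF // => /(_ Yj) hq; rewrite E_z.
have := fl_div_err e_ge0 e_le1 c0 (a_ge0 j i) ht (z_le j i) Yj hq erefl.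
rewrite mulrC => /le_trans; apply.
rewrite -!mulrA; apply: ler_wpM2r; first by rewrite mulr_ge0.
by rewrite cE !(exprS _ n.+3) (exprS _ n.+2); move: c0; lra.
Qed.

Let col_sqr (j : 'I_n) : R := \sum_k Y k j ^+ 2.

(** Invariant of the induction over columns: the positive pivot permits the later divisions, and the
    column bound makes the errors proportional to [nu]. *)
Let good (j : 'I_n) :=
  [/\ 0 < Y j j, col_sqr j <= 2 * nu & `|E j j| <= 3 * c * e * nu].

Let c_ge0 : 0 <= c. Proof. by rewrite cE addr_ge0 // exprn_ge0. Qed.

(** Arithmetic-geometric mean inequality for each term. The weight [x] will be an entry of the test
    vector, or 1. *)
Let cross_le (j i : 'I_n) (b x : R) : \sum_(k : 'I_n | (k < i)%N) Y k i ^+ 2 <= b ->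
  (j <= i)%N -> col_sqr j <= 2 * nu ->
  `|x| * \sum_(k : 'I_n | (k < j)%N) `|Y k j| * `|Y k i| <= nu * x ^+ 2 + b / 2.
Proof.
move=> hb ji hj; rewrite mulr_sumr.
apply: (@le_trans _ _ (\sum_(k : 'I_n | (k < j)%N) (x ^+ 2 * Y k j ^+ 2 + Y k i ^+ 2) / 2)).
  apply: ler_sum => k _; rewrite mulrA -!normrM.
  have := sqr_ge0 (`|x * Y k j| - `|Y k i|).
  rewrite sqrrB !real_normK ?num_real // exprMn; rewrite -mulr_natl !normrM; lra.
rewrite -mulr_suml big_split /= -mulr_sumr.
have h1 : \sum_(k : 'I_n | (k < j)%N) Y k j ^+ 2 <= 2 * nu.
  apply: le_trans hj; rewrite /col_sqr [leRHS](bigID [pred k : 'I_n | (k < j)%N]) /=.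
  by rewrite lerDl; apply: sumr_ge0 => k _; exact: sqr_ge0.
have h2 : \sum_(k : 'I_n | (k < j)%N) Y k i ^+ 2 <= b.
  apply: le_trans hb; rewrite [leRHS](bigID [pred k : 'I_n | (k < j)%N]) /=.
  rewrite [X in _ <= X + _](eq_bigl [pred k : 'I_n | (k < j)%N]) ?lerDl; last first.
    by move=> k /=; case kj: (k < j)%N; rewrite ?andbF // (leq_trans kj).
  by apply: sumr_ge0 => k _; exact: sqr_ge0.
have := ler_wpM2l (sqr_ge0 x) h1; lra.
Qed.

Let E_pair j l : good j -> good l -> `|E j l| <= 3 * c * e * nu.
Proof.
move=> gj gl; wlog jl : j l gj gl / (j <= l)%N.
  by move=> h; have [/h|/ltnW/h] := leqP j l; [exact | rewrite E_tr; exact].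
have [jj cj Ej] := gj; have [ll cl El] := gl.
move: jl; rewrite leq_eqVlt => /orP[/eqP/val_inj <- //|jl].
apply: (le_trans (E_off jl (lt0r_neq0 jj))).
have -> : 3 * c * e * nu = c * e * (3 * nu) by ring.
apply: ler_wpM2l; first exact: mulr_ge0.
have cl' : \sum_(k : 'I_n | (k < l)%N) Y k l ^+ 2 <= 2 * nu.
  apply: le_trans cl; rewrite /col_sqr [leRHS](bigID [pred k : 'I_n | (k < l)%N]) /=.
  by rewrite lerDl; apply: sumr_ge0 => k _; exact: sqr_ge0.
have := @cross_le j l _ 1 cl' (ltnW jl) cj; rewrite normr1 mul1r expr1n mulr1.
have -> : 2 * nu / 2 = nu by field.
have := A_le j l; rewrite /a; lra.
Qed.

(* If [Y w] is the part of column [i] above the diagonal, the form of [A] at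
   [w - e_i] is [A i i - r2] up to rounding errors. As it is at least
   [mu * (sqn w + 1)], the pivot is positive and no breakdown occurs. *)
Lemma fl_chol_pivots (i : 'I_n) : good i.
Proof.
have [b] := ubnP (val i); elim: b => // b IHb in i * => /ltnSE ib.
have IH (j : 'I_n) : (j < i)%N -> good j by move=> ji; apply: IHb; exact: leq_trans ib.
have [w w0 Yw] : exists2 w : 'cV_n, forall j : 'I_n, (i <= j)%N -> w j 0 = 0 &
    forall k : 'I_n, (Y *m w) k 0 = if (k < i)%N then Y k i else 0.
  by apply: leading_trig_solve => // j /IH[/lt0r_neq0].
have [mu0 e0 se snu] := And4 mu_gt0 e_ge0 small_e small_nu.
pose r2 : R := \sum_(k : 'I_n | (k < i)%N) Y k i ^+ 2.
have r2_ge0 : 0 <= r2 by apply: sumr_ge0 => k _; exact: sqr_ge0.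
pose W := sqn w; have W0 : 0 <= W by exact: sqn_ge0.
pose ei : 'cV[R]_n := delta_mx i 0.
have nu0 : 0 <= nu by exact: le_trans (A_le i i).
have n1 : 1 <= n%:R :> R by rewrite ler1n (leq_ltn_trans _ (ltn_ord i)).
have ww : bil A w w = r2 - bil E w w.
  rewrite /E bilBl -sqn_mulmx; have -> : sqn (Y *m w) = r2; last by ring.
  rewrite /r2 [RHS]big_mkcond; apply: eq_bigr => k _; rewrite Yw.
  by case: ifP; rewrite // expr0n.
have wi : bil A w ei = r2 - bil E w ei.
  rewrite /E bilBl; have -> : bil (Y^T *m Y) w ei = r2; last by ring.
  rewrite /bil mulmxA -trmx_mul -mulmxA -colE mxE /r2 [RHS]big_mkcond.
  by apply: eq_bigr => k _; rewrite mxE Yw mxE; case: ifP; rewrite ?mul0r // expr2.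
(* As [w i 0 = 0], the squared norm of [w - ei] is [W + 1]; definiteness there bounds the exact
   pivot [A i i - r2] from below. *)
have psd : mu * (W + 1) <= A i i - r2 - bil E w w + 2 * bil E w ei.
  have := A_def (w - ei).
  have -> : sqn (w - ei) = W + 1.
    rewrite /W /sqn (bigD1 i) //= [in RHS](bigD1 i) //= !mxE !eqxx w0 //=.
    rewrite (eq_bigr (fun k => w k 0 ^+ 2)); first by ring.
    by move=> k ki; rewrite !mxE (negbTE ki) subr0.
  have -> : bil A (w - ei) (w - ei) = bil A w w - 2 * bil A w ei + A i i.
    have h1 : bil A w ei = bil A ei w by exact: bilC.
    have -> : A i i = bil A ei ei by rewrite /bil trmx_delta -rowE -colE !mxE.
    rewrite mulr_natl mulr2n {2}h1 /bil [(w - ei)^T]linearB /= !(mulmxBl, mulmxBr).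
    by rewrite !mxE; ring.
  rewrite ww wi; lra.
have bww : `|bil E w w| <= g * e * nu * W.
  (* Only the leading block of [E] meets the support of [w], and there the induction hypothesis
     bounds every entry. *)
  pose E' := \matrix_(j, l) if (j < i)%N && (l < i)%N then E j l else 0.
  have -> : bil E w w = bil E' w w.
    rewrite !bilE; apply: eq_bigr => j _; apply: eq_bigr => l _; rewrite [E' _ _]mxE.
    have [ji|/w0 ->] /= := ltnP j i; last by rewrite !mul0r.
    by have [li|/w0 ->] /= := ltnP l i; rewrite ?mulr0 ?mul0r.
  apply: (le_trans (bil_le _ _)); apply: ler_wpM2r => //.
  have -> : g * e * nu = (n * n)%:R * (3 * c * e * nu) by rewrite gE; ring.
  apply: onorm_le => j l; rewrite mxE; case: ifP => [/andP[ji li]|_].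
    by apply: E_pair; exact: IH.
  by rewrite normr0 !mulr_ge0.
have geE : g * e = 3 * n%:R * (n%:R * (c * e)) by rewrite gE natrM; ring.
have cen : c * e <= n%:R * (c * e) by rewrite ler_peMl // mulr_ge0.
have cen2 : n%:R * (c * e) * 3 <= g * e.
  have q0 : 0 <= n%:R * (c * e) by rewrite !mulr_ge0.
  by rewrite geE; have := ler_wpM2r q0 n1; lra.
have ce_ge0 : 0 <= c * e by rewrite mulr_ge0.
(* Column [i] is not yet known to be bounded, hence [r2] stays in the bound on its residual. *)
have bwi : `|bil E w ei| <= g * e * (nu * W + nu + r2).
  have -> : bil E w ei = \sum_j w j 0 * E j i.
    by rewrite /bil -mulmxA -colE mxE; apply: eq_bigr => j _; rewrite !mxE.
  apply: (le_trans (ler_norm_sum _ _ _)).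
  apply: (@le_trans _ _ (\sum_j c * e * (2 * nu * w j 0 ^+ 2 + nu + r2))).
    apply: ler_sum => j _; rewrite normrM; have [ji|/w0 ->] := ltnP j i; last first.
      rewrite normr0 mul0r mulr_ge0 // addr_ge0 // addr_ge0 // mulr_ge0 ?sqr_ge0 //.
      by rewrite mulr_ge0.
    have [jj cj _] := IH j ji.
    have := ler_wpM2l (normr_ge0 (w j 0)) (E_off ji (lt0r_neq0 jj)).
    move/le_trans; apply; rewrite mulrCA; apply: ler_wpM2l => //; rewrite mulrDr.
    have := @cross_le j i _ (w j 0) (lexx r2) (ltnW ji) cj.
    have h1 : `|w j 0| * `|A j i| <= `|w j 0| * nu by exact: ler_wpM2l.
    have h2 : `|w j 0| * nu <= (w j 0 ^+ 2 + 1) * nu.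
      apply: ler_wpM2r => //; have := sqr_ge0 (`|w j 0| - 1).
      by rewrite sqrrB1 real_normK ?num_real //; have := normr_ge0 (w j 0); lra.
    lra.
  rewrite -mulr_sumr !big_split /= -mulr_sumr !sumr_const card_ord.
  rewrite -/W -[nu *+ n]mulr_natl -[r2 *+ n]mulr_natl.
  have h1 : nu * W <= n%:R * (nu * W) by rewrite ler_peMl // mulr_ge0.
  apply: (@le_trans _ _ (c * e * (2 * n%:R * (nu * W + nu + r2)))).
    apply: ler_wpM2l => //.
    have h2 : 0 <= n%:R * nu by rewrite mulr_ge0.
    have h3 : 0 <= n%:R * r2 by rewrite mulr_ge0.
    rewrite -/(sqn w) -/W; lra.
  have h4 : 0 <= nu * W + nu + r2 by rewrite !addr_ge0 ?mulr_ge0.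
  have h5 := ler_wpM2r h4 cen2.
  have h6 : 0 <= n%:R * (c * e) * (nu * W + nu + r2) by rewrite !mulr_ge0.
  lra.
have [t ht hq] := pivot (leqnn i).
have aE : a i i <= nu + r2.
  rewrite /a lerD // /r2; apply: ler_sum => k _.
  by rewrite -normrM -expr2 ger0_norm // sqr_ge0.
have zE : z i i = A i i - r2.
  by rewrite /z /r2; under eq_bigr do rewrite -expr2.
have g0 : 0 <= g by rewrite gE !mulr_ge0.
have ge0 : 0 <= g * e by rewrite mulr_ge0.
have genu : 0 <= g * e * nu by rewrite mulr_ge0.
have genuW : 0 <= g * e * nu * W by rewrite mulr_ge0.
have muW := ler_wpM2r W0 small_nu.
have Aii : A i i <= nu by rewrite (le_trans (ler_norm _)).
have ger2 := ler_wpM2r r2_ge0 small_e.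
move: bww bwi; rewrite !ler_norml => /andP[bww1 bww2] /andP[bwi1 bwi2].
(* In [psd] the errors in [W] are absorbed by [mu * W], and those in [r2] by [r2] itself. *)
have r2_le : r2 <= 2 * nu by lra.
have ger2' := ler_wpM2l ge0 r2_le.
have ht' : `|t - z i i| <= g * e * (nu + r2).
  apply: (le_trans ht); apply: ler_pM => //.
  have : 2 ^+ n.+2 * e <= c * e.
    by apply: ler_wpM2r => //; rewrite cE !(exprS _ n.+3) (exprS _ n.+2); move: c0; lra.
  lra.
(* The exact pivot is at least [mu] up to a few multiples of [g * e * nu], each at most
   [mu / 20]. *)
have t0 : 0 < t.
  move: ht'; rewrite ler_norml zE => /andP[ht1 _]; lra.
move: hq; rewrite eqxx => /(_ (ltW t0)) hq.
have Yii : 0 < Y i i.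
  have [d hd ->] := hq; rewrite mulr_gt0 ?sqrtr_gt0 //.
  (* Strictness matters: a relative error equal to -1 would annihilate the root. *)
  have e1 : e < 1.
    have : 3 * e <= g * e.
      have : 3 * e <= c * e by apply: ler_wpM2r => //; rewrite cE lerDr exprn_ge0.
      lra.
    lra.
  by move: hd; rewrite ler_norml => /andP[]; lra.
have Eii : `|E i i| <= 3 * c * e * nu.
  rewrite E_z -expr2.
  apply: (le_trans (fl_sqrt_err e_ge0 e_le1 c0 (ltW t0) ht (z_le i i) hq)).
  have -> : 4 * 2 ^+ n.+2 + 3 = c by rewrite cE !(exprS _ n.+3) (exprS _ n.+2); ring.
  rewrite -!mulrA [leRHS]mulrCA; apply: ler_wpM2l => //.
  by rewrite [leRHS]mulrCA; apply: ler_wpM2l => //; lra.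
split => //.
(* The diagonal residual compares the squared norm of the column with [A i i], which yields the
   column bound of the invariant. *)
have : E i i = col_sqr i - A i i.
  by rewrite /E !mxE; congr (_ - _); apply: eq_bigr => k _; rewrite mxE expr2.
move: Eii; rewrite ler_norml => /andP[_ h1] h2.
have : 20 * (c * e) * nu <= 1 * nu by apply: ler_wpM2r => //; lra.
lra.
Qed.

Lemma fl_chol_err :
  (forall i, 0 < Y i i) /\ onorm (Y^T *m Y - A) <= g * e * nu.
Proof.
split=> [i|]; first by have [] := fl_chol_pivots i.
have -> : g * e * nu = (n * n)%:R * (3 * c * e * nu) by rewrite gE; ring.
by apply: onorm_le => j l; apply: E_pair; exact: fl_chol_pivots.
Qed.

End Cholesky.

(** * Extreme singular values *)

Section SingularValues.
Variable R : realType.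

(* No compactness is used: were [M - l%:M] invertible, with [l] the infimum of
   the Rayleigh quotients, this semidefinite matrix would be definite with a
   quantitative lower bound, and [l] could be increased. *)
Lemma eigenvalue_inf_rayleigh n (M : 'M[R]_n.+1) : M^T = M ->
  exists2 l, eigenvalue M l & forall y, l * sqn y <= bil M y y.
Proof.
move=> sM.
pose E : set R := [set bil M y y | y in [set y | sqn y = 1]]%classic.
have E0 : (E !=set0)%classic.
  by exists (bil M (delta_mx 0 0) (delta_mx 0 0)), (delta_mx 0 0) => //=; rewrite sqn_delta.
have Elb : has_lbound E.
  exists (- onorm M) => _ [y /= y1 <-].
  by have := bil_le M y; rewrite y1 mulr1 ler_norml => /andP[].
pose l := inf E.
have bilZ a y (P : 'M[R]_n.+1) : bil P (a *: y) (a *: y) = a ^+ 2 * bil P y y.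
  rewrite /bil [(a *: y)^T]linearZ /= -!scalemxAl -scalemxAr !mxE; ring.
have scale (P : 'M[R]_n.+1) c : (forall y, sqn y = 1 -> c <= bil P y y) ->
    forall y, c * sqn y <= bil P y y.
  move=> h y; have [/sqn_eq0 ->|y0] := eqVneq (sqn y) 0.
    by rewrite -(scale0r 0) bilZ sqnZ !expr0n !mul0r mulr0.
  have y_gt0 : 0 < sqn y by rewrite lt_neqAle eq_sym y0 sqn_ge0.
  pose a := (Num.sqrt (sqn y))^-1.
  have a2 : a ^+ 2 = (sqn y)^-1 by rewrite exprVn sqr_sqrtr ?sqn_ge0.
  have := h (a *: y); rewrite sqnZ bilZ a2 mulVf // => /(_ erefl).
  by rewrite -ler_pdivrMl ?invr_gt0 // invrK mulrC.
have lM y : l * sqn y <= bil M y y.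
  by apply: scale => {}y y1; apply: ge_inf => //; exists y.
exists l => //; have [N NE] : exists N, N = M - l%:M by exists (M - l%:M).
have sN : N^T = N by rewrite NE linearB /= sM tr_scalar_mx.
have bN y : bil N y y = bil M y y - l * sqn y.
  by rewrite NE bilBl {2}/bil mul_mx_scalar -scalemxAl mxE -sqnE.
have N0 y : 0 <= bil N y y by rewrite bN subr_ge0.
rewrite /eigenvalue /eigenspace kermx_eq0 row_free_unit -NE; apply/negP => Nu.
(* Cauchy-Schwarz inequality for the semidefinite form of [N], from the sign of a quadratic
   polynomial in [t]. *)
have cs y : bil N (N *m y) y ^+ 2 <= bil N y y * bil N (N *m y) (N *m y).
  set z := N *m y.
  have quad t : 0 <= bil N y y * t ^+ 2 - 2 * t * bil N z y + bil N z z.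
    have -> : bil N y y * t ^+ 2 - 2 * t * bil N z y + bil N z z = bil N (t *: y - z) (t *: y - z).
      have yz : bil N y z = bil N z y by exact: bilC.
      rewrite /bil [(t *: y - z)^T]linearB /= [(t *: y)^T]linearZ /= !(mulmxBl, mulmxBr).
      rewrite -!(scalemxAl, scalemxAr) scalerA.
      move: yz; rewrite /bil; move: (y^T *m N *m y) (z^T *m N *m y) (y^T *m N *m z) (z^T *m N *m z).
      move=> A B C D e1; rewrite !mxE. rewrite e1; ring.
    exact: N0.
  have [y0|y0] := eqVneq (bil N y y) 0.
    have [/eqP ->|z0] := boolP (bil N z y == 0); first by rewrite y0 expr0n mul0r.
    (* With leading coefficient 0 the polynomial is affine, and at this [t] it would take the value
       -1. *)
    have := quad ((bil N z z + 1) / (2 * bil N z y)); rewrite y0.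
    have -> : 0 * ((bil N z z + 1) / (2 * bil N z y)) ^+ 2 -
       2 * ((bil N z z + 1) / (2 * bil N z y)) * bil N z y + bil N z z = -1 by field.
    by rewrite lerNr oppr0 ler10.
  have y_gt0 : 0 < bil N y y by rewrite lt_neqAle eq_sym y0 N0.
  have := quad (bil N z y / bil N y y).
  have -> : bil N y y * (bil N z y / bil N y y) ^+ 2 -
    2 * (bil N z y / bil N y y) * bil N z y + bil N z z
    = bil N z z - bil N z y ^+ 2 / bil N y y by field.
  by rewrite subr_ge0 ler_pdivrMr // mulrC.
(* As [bil N (N *m y) y] is [sqn (N *m y)], the form at [y] controls the image of [y]. *)
have Nsq y : sqn (N *m y) <= onorm N * bil N y y.
  have h1 : bil N (N *m y) y = sqn (N *m y) by rewrite sqnE /bil -mulmxA.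
  have h2 : bil N (N *m y) (N *m y) <= onorm N * sqn (N *m y).
    by rewrite (le_trans (ler_norm _)) ?bil_le.
  have := cs y; rewrite h1; have [->|z0] := eqVneq (sqn (N *m y)) 0.
    by move=> _; rewrite mulr_ge0 ?onorm_ge0.
  have z_gt0 : 0 < sqn (N *m y) by rewrite lt_neqAle eq_sym z0 sqn_ge0.
  move=> h3; rewrite -(ler_pM2r z_gt0) -expr2 (le_trans h3) //.
  by have := ler_wpM2l (N0 y) h2; lra.
(* Recovering [y] from [N *m y] makes the form definite with constant [c^-1]; the summand 1 ensures
   that [c] is positive. *)
pose c := onorm N * onorm (invmx N) ^+ 2 + 1.
have c_gt0 : 0 < c by rewrite ltr_pwDr // mulr_ge0 ?exprn_ge0 ?onorm_ge0.
have hc y : sqn y <= c * bil N y y.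
  have {1}-> : y = invmx N *m (N *m y) by rewrite mulKmx.
  apply: (le_trans (sqn_mulmx_le _ _)).
  apply: (le_trans (ler_wpM2l _ (Nsq y))); first by rewrite exprn_ge0 ?onorm_ge0.
  by rewrite mulrA; apply: (ler_wpM2r (N0 y)); rewrite mulrC /c lerDl.
have : l + c^-1 <= l.
  apply: lb_le_inf => // _ [y /= y1 <-].
  have := hc y; rewrite bN y1 mulr1 -ler_pdivrMl // mulr1; lra.
by have := c_gt0; rewrite -invr_gt0; lra.
Qed.

Lemma eigenvalue_sup_rayleigh n (M : 'M[R]_n.+1) : M^T = M ->
  exists2 l, eigenvalue M l & forall y, bil M y y <= l * sqn y.
Proof.
move=> sM; have [|l /eigenvalueP[v vl v0] lM] := @eigenvalue_inf_rayleigh _ (- M).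
  by rewrite linearN /= sM.
exists (- l).
  by apply/eigenvalueP; exists v => //; rewrite scaleNr -vl mulmxN opprK.
move=> y; have := lM y; rewrite /bil mulmxN mulNmx mxE; lra.
Qed.

(** Eigenvectors are row vectors, hence the transposition. An eigenvalue becomes a quotient of
    squared norms, from which its sign and bounds follow. *)
Lemma eigenvalue_gram m n (A : 'M[R]_(m, n)) l : eigenvalue (A^T *m A) l ->
  exists2 v : 'cV_n, 0 < sqn v & sqn (A *m v) = l * sqn v.
Proof.
move=> /eigenvalueP[v vl v0]; exists v^T.
  rewrite lt_neqAle sqn_ge0 andbT eq_sym; apply: contra v0 => /eqP/sqn_eq0.
  by move/(congr1 trmx); rewrite trmxK trmx0 => /eqP.
by rewrite sqn_mulmx /bil trmxK vl -scalemxAl mxE sqnE trmxK.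
Qed.

(** The extreme Rayleigh quotients of the Gram matrix are eigenvalues, so the extreme gains of [A]
    are themselves singular values. *)
Lemma singvals_bounds m n (A : 'M[R]_(m, n.+1)) :
  exists smin smax : R, [/\ singvals A smin, singvals A smax,
    forall y, smin ^+ 2 * sqn y <= sqn (A *m y) &
    forall y, sqn (A *m y) <= smax ^+ 2 * sqn y].
Proof.
have sM : (A^T *m A)^T = A^T *m A by rewrite trmx_mul trmxK.
have lge0 l : eigenvalue (A^T *m A) l -> 0 <= l.
  move=> /eigenvalue_gram[v v0 Av]; have := sqn_ge0 (A *m v).
  by rewrite Av pmulr_lge0.
have [l el lM] := eigenvalue_inf_rayleigh sM.
have [l' el' lM'] := eigenvalue_sup_rayleigh sM.
exists (Num.sqrt l), (Num.sqrt l').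
have l0 := lge0 _ el; have l0' := lge0 _ el'.
by split; rewrite /singvals /= ?sqrtr_ge0 ?sqr_sqrtr // => y; rewrite sqn_mulmx.
Qed.

Lemma singvals_le m n (A : 'M[R]_(m, n)) a b t : 0 <= a -> 0 <= b ->
  (forall y, a ^+ 2 * sqn y <= sqn (A *m y)) ->
  (forall y, sqn (A *m y) <= b ^+ 2 * sqn y) ->
  singvals A t -> a <= t <= b.
Proof.
move=> a0 b0 ha hb [t0 /eigenvalue_gram[v v0 Av]].
have := ha v; have := hb v; rewrite Av !ler_pM2r // => h1 h2.
by apply/andP; split; rewrite -(@ler_pXn2r _ 2) ?nnegrE.
Qed.

Lemma singvals_inf_sup m n (A : 'M[R]_(m, n.+1)) :
  [/\ 0 <= inf (singvals A), inf (singvals A) <= sup (singvals A),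
    forall y, inf (singvals A) ^+ 2 * sqn y <= sqn (A *m y) &
    forall y, sqn (A *m y) <= sup (singvals A) ^+ 2 * sqn y].
Proof.
have [smin [smax [hmin hmax lo hi]]] := singvals_bounds A.
have [s0 _] := hmin; have [s1 _] := hmax.
have bnd t : singvals A t -> smin <= t <= smax by exact: singvals_le.
have -> : inf (singvals A) = smin.
  apply/eqP; rewrite eq_le; apply/andP; split.
    by apply: ge_inf => //; exists smin => t /bnd/andP[].
  by apply: lb_le_inf; [exists smin | move=> t /bnd/andP[]].
have -> : sup (singvals A) = smax.
  apply/eqP; rewrite eq_le; apply/andP; split.
    by apply: ge_sup; [exists smin | move=> t /bnd/andP[]].
  by apply: ub_le_sup => //; exists smax => t /bnd/andP[].
by split=> //; have /andP[] := bnd _ hmin.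
Qed.

(** [s] is the smallest singular value and [k * s] the largest; this replaces the extended real
    [kappa] by two reals. *)
Lemma kappa_fin m n (A : 'M[R]_(m, n)) : (0 < n)%N -> kappa A != +oo%E ->
  exists s k : R, [/\ kappa A = k%:E, 0 < s, 1 <= k, k * s <= onorm A &
    (forall y, s ^+ 2 * sqn y <= sqn (A *m y)) /\
    (forall y, sqn (A *m y) <= (k * s) ^+ 2 * sqn y)].
Proof.
case: n A => // n A _; have [i0 is_ lo hi] := singvals_inf_sup A.
rewrite /kappa; case: (eqVneq (inf (singvals A)) 0) => [_|i_neq0 _]; first by rewrite eqxx.
have i_gt0 : 0 < inf (singvals A) by rewrite lt_neqAle eq_sym i_neq0.
exists (inf (singvals A)), (sup (singvals A) / inf (singvals A)).
rewrite divfK //; split => //; first by rewrite ler_pdivlMr // mul1r.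
have [smin [smax [hmin _ _ _]]] := singvals_bounds A.
apply: ge_sup; first by exists smin.
move=> t /(singvals_le (lexx 0) (onorm_ge0 A)) h.
apply: proj2 (andP (h _ _)) => y; last exact: sqn_mulmx_le.
by rewrite expr0n mul0r sqn_ge0.
Qed.

(** Used to see that the first block column is no worse conditioned than the whole matrix, as the
    assumption on [IO] requires. *)
Lemma kappa_le m n (A : 'M[R]_(m, n)) (s k : R) : (0 < n)%N -> 0 < s -> 0 <= k ->
  (forall y, s ^+ 2 * sqn y <= sqn (A *m y)) ->
  (forall y, sqn (A *m y) <= (k * s) ^+ 2 * sqn y) ->
  (kappa A <= k%:E)%E.
Proof.
case: n A => // n A _ s0 k0 lo hi; have [smin [smax [hmin hmax _ _]]] := singvals_bounds A.
have bnd t : singvals A t -> s <= t <= k * s.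
  by apply: singvals_le => //; rewrite ?mulr_ge0 // ltW.
have hs : s <= inf (singvals A).
  by apply: lb_le_inf; [exists smin | move=> t /bnd/andP[]].
have hk : sup (singvals A) <= k * s.
  by apply: ge_sup; [exists smin | move=> t /bnd/andP[]].
have i_gt0 := lt_le_trans s0 hs.
rewrite /kappa gt_eqF // lee_fin ler_pdivrMr // (le_trans hk) //.
by rewrite ler_wpM2l.
Qed.

Lemma vnorm_sqn n (y : 'cV[R]_n) : vnorm y = Num.sqrt (sqn y).
Proof. by []. Qed.

Lemma vnorm_mulmx_le m n (A : 'M[R]_(m, n)) y :
  vnorm y <= 1 -> vnorm (A *m y) <= onorm A.
Proof.
rewrite !vnorm_sqn => y1.
have y1' : sqn y <= 1 by rewrite -(sqr_sqrtr (sqn_ge0 y)) exprn_ile1 // sqrtr_ge0.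
rewrite -(@ler_pXn2r _ 2) ?nnegrE ?sqrtr_ge0 ?onorm_ge0 // sqr_sqrtr ?sqn_ge0 //.
by apply: (le_trans (sqn_mulmx_le _ _)); rewrite ler_piMr // exprn_ge0 ?onorm_ge0.
Qed.

Lemma mxnorm2_le_onorm m n (A : 'M[R]_(m, n)) : mxnorm2 A <= onorm A.
Proof.
apply: ge_sup; last by move=> _ [y /= y1 <-]; exact: vnorm_mulmx_le.
exists (vnorm (A *m 0)), 0 => //=.
by rewrite vnorm_sqn /sqn big1 ?sqrtr0 // => i _; rewrite mxE expr0n.
Qed.

Lemma onorm_le_mxnorm2 m n (A : 'M[R]_(m, n)) :
  onorm A <= (m * n)%:R * mxnorm2 A.
Proof.
apply: onorm_le => i j; apply: (@le_trans _ _ (vnorm (A *m delta_mx j 0))).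
  rewrite vnorm_sqn -colE -[`|_|]sqrtr_sqr ler_sqrt ?sqn_ge0 //.
  by have := ler_sqr_sqn (col j A) i; rewrite mxE.
apply: ub_le_sup.
  by exists (onorm A) => _ [y /= y1 <-]; exact: vnorm_mulmx_le.
by exists (delta_mx j 0) => //=; rewrite vnorm_sqn sqn_delta sqrtr1.
Qed.

Lemma mxnorm2_ge0 m n (A : 'M[R]_(m, n)) : 0 <= mxnorm2 A.
Proof.
apply: (@le_trans _ _ (vnorm (A *m 0))); first by rewrite vnorm_sqn sqrtr_ge0.
apply: ub_le_sup.
  by exists (onorm A) => _ [y /= y1 <-]; exact: vnorm_mulmx_le.
exists 0 => //=; rewrite vnorm_sqn /sqn big1 ?sqrtr0 // => i _.
by rewrite mxE expr0n.
Qed.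

End SingularValues.

(** * One pass of the loop *)

Section StepLemmas.
Variable R : realType.

(** Unlike [mxE], this leaves matrix products unexpanded, so that [ring] treats their entries as
    atoms. *)
Lemma addmxE m n (A B : 'M[R]_(m, n)) i j : (A + B) i j = A i j + B i j.
Proof. by rewrite mxE. Qed.

Lemma oppmxE m n (A : 'M[R]_(m, n)) i j : (- A) i j = - A i j.
Proof. by rewrite mxE. Qed.

Lemma unitmx_gain n (M : 'M[R]_n) s c : 0 < s ->
  (forall y, s * sqn y <= c * sqn (M *m y)) -> M \in unitmx.
Proof.
move=> s0 h; rewrite -unitmx_tr -row_free_unit -kermx_eq0.
apply/rowV0P => v /sub_kermxP/(congr1 trmx); rewrite trmx_mul trmxK trmx0 => Mv.
have := h v^T; rewrite Mv /sqn [X in c * X]big1 ?mulr0; last first.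
  by move=> i _; rewrite mxE expr0n.
rewrite pmulr_rle0 // -/(sqn v^T) => v0.
apply: trmx_inj; rewrite trmx0; apply: sqn_eq0.
by apply/eqP; rewrite eq_le v0 sqn_ge0.
Qed.

Lemma onorm_orth m r (Q : 'M[R]_(m, r)) :
  onorm (1%:M - Q^T *m Q) <= 1 -> onorm Q <= (m * r)%:R * 2.
Proof.
move=> h; apply: onorm_le => i j; apply: ler_norm_sqr => //.
apply: (le_trans (sqr_entry_gram Q i j)).
have := ler_entry_onorm (1%:M - Q^T *m Q) j j; rewrite addmxE oppmxE mxE eqxx mulr1n.
by rewrite ler_norml => /andP[]; lra.
Qed.

Lemma sqn_mulmx_le_gain m n (A : 'M[R]_(m, n)) c y :
  onorm A <= c -> sqn (A *m y) <= c ^+ 2 * sqn y.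
Proof.
move=> h; apply: (le_trans (sqn_mulmx_le _ _)); apply: ler_wpM2r; first exact: sqn_ge0.
by rewrite lerXn2r ?nnegrE // (le_trans (onorm_ge0 A)).
Qed.

(* [Qp *m S] lies, up to rounding errors, in the range of the preceding columns
   [Xp], so that [V] inherits the smallest singular value of [row_mx Xp X]. *)
Lemma projected_gain m r q (Xp Qp : 'M[R]_(m, r)) (X V : 'M[R]_(m, q))
    (Tp : 'M[R]_r) (S : 'M[R]_(r, q)) s : 0 < s ->
  (forall z y, s ^+ 2 * (sqn z + sqn y) <= sqn (Xp *m z + X *m y)) ->
  onorm (Qp *m Tp - Xp) <= s / 4 -> onorm (V - (X - Qp *m S)) <= s / 4 ->
  forall y, s ^+ 2 * sqn y <= 4 * sqn (V *m y).
Proof.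
move=> s0 lo hE hV y.
have s2 : 0 < s ^+ 2 by rewrite exprn_gt0.
(* The preceding columns have gain [s] and differ from [Qp *m Tp] by at most [s / 4], so [Tp] has
   trivial kernel. *)
have TpU : Tp \in unitmx.
  apply: (@unitmx_gain _ _ (s ^+ 2 / 4) (onorm Qp ^+ 2)) => [|z]; first lra.
  have := lo z 0; rewrite mulmx0 addr0.
  have -> : sqn (0 : 'cV[R]_q) = 0 by rewrite /sqn big1 // => i _; rewrite mxE expr0n.
  rewrite addr0 => lz.
  have Xz : Xp *m z = Qp *m (Tp *m z) + - ((Qp *m Tp - Xp) *m z).
    by rewrite mulmxA mulmxBl opprB addrC subrK.
  have := sqnD (Qp *m (Tp *m z)) (- ((Qp *m Tp - Xp) *m z)); rewrite -Xz sqnN.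
  have := sqn_mulmx_le_gain z hE.
  have := sqn_mulmx_le Qp (Tp *m z).
  have : 0 <= s ^+ 2 * sqn z by rewrite mulr_ge0 ?sqn_ge0 // ltW.
  have -> : (s / 4) ^+ 2 * sqn z = s ^+ 2 * sqn z / 16 by field.
  have -> : s ^+ 2 / 4 * sqn z = s ^+ 2 * sqn z / 4 by field.
  lra.
(* With this [z], [Qp *m S *m y] equals [Xp *m z] up to the residual, so [V *m y] is close to
   [X *m y - Xp *m z]. *)
pose z := invmx Tp *m (S *m y); have Tz : Tp *m z = S *m y by rewrite mulKVmx.
have := lo (- z) y.
have -> : Xp *m - z + X *m y =
    V *m y + ((Qp *m Tp - Xp) *m z - (V - (X - Qp *m S)) *m y).
  rewrite !(mulmxBl, mulmxN) -!mulmxA Tz.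
  by apply/matrixP => i j; rewrite !(addmxE, oppmxE); ring.
rewrite sqnN => lz.
have := sqnD (V *m y) ((Qp *m Tp - Xp) *m z - (V - (X - Qp *m S)) *m y).
have := sqnD ((Qp *m Tp - Xp) *m z) (- ((V - (X - Qp *m S)) *m y)); rewrite sqnN.
(* No bound on [z] is needed: its error term is absorbed by [s ^+ 2 * sqn z] on the left of [lz]. *)
have := sqn_mulmx_le_gain z hE.
have := sqn_mulmx_le_gain y hV.
have -> : (s / 4) ^+ 2 * sqn z = s ^+ 2 * sqn z / 16 by field.
have -> : (s / 4) ^+ 2 * sqn y = s ^+ 2 * sqn y / 16 by field.
have : 0 <= s ^+ 2 * sqn z by rewrite mulr_ge0 ?sqn_ge0 // ltW.
have : 0 <= s ^+ 2 * sqn y by rewrite mulr_ge0 ?sqn_ge0 // ltW.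
lra.
Qed.

(** The two perturbations, by [Y^T *m Y] and by rounding, each cost at most a quarter of
    [sqn (V *m y)]. *)
Lemma corrected_gram_gain m r q (V : 'M[R]_(m, q)) (Y : 'M[R]_(r, q)) (A : 'M[R]_q) s :
  0 < s -> (forall y, s ^+ 2 * sqn y <= 4 * sqn (V *m y)) ->
  onorm Y <= s / 4 -> onorm (A - (V^T *m V - Y^T *m Y)) <= s ^+ 2 / 16 ->
  forall y, sqn (V *m y) <= 2 * bil A y y.
Proof.
move=> s0 lo hY hA y.
have -> : A = (A - (V^T *m V - Y^T *m Y)) + (V^T *m V - Y^T *m Y) by rewrite subrK.
rewrite bilDl [bil (V^T *m V - _) _ _]bilBl -!sqn_mulmx.
have := bil_le (A - (V^T *m V - Y^T *m Y)) y; rewrite ler_norml => /andP[h _].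
have h2 := ler_wpM2r (sqn_ge0 y) hA; have h3 := sqn_mulmx_le_gain y hY; have := lo y.
move: h2 h3; have -> : (s / 4) ^+ 2 * sqn y = s ^+ 2 * sqn y / 16 by field.
have -> : s ^+ 2 / 16 * sqn y = s ^+ 2 * sqn y / 16 by field.
lra.
Qed.

(** [A] retains half of [sqn (V *m y)], and the residual takes away at most a quarter. *)
Lemma cholesky_gain m q (V : 'M[R]_(m, q)) (A T : 'M[R]_q) s :
  0 < s -> (forall y, s ^+ 2 * sqn y <= 4 * sqn (V *m y)) ->
  (forall y, sqn (V *m y) <= 2 * bil A y y) ->
  onorm (T^T *m T - A) <= s ^+ 2 / 16 ->
  forall y, sqn (V *m y) <= 4 * sqn (T *m y).
Proof.
move=> s0 lo hA hT y; rewrite (sqn_mulmx T).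
have -> : T^T *m T = (T^T *m T - A) + A by rewrite subrK.
rewrite bilDl; have := bil_le (T^T *m T - A) y; rewrite ler_norml => /andP[h _].
have := ler_wpM2r (sqn_ge0 y) hT.
have -> : s ^+ 2 / 16 * sqn y = s ^+ 2 * sqn y / 16 by field.
have := lo y; have := hA y; lra.
Qed.

(** Cholesky reads the upper triangle only, whereas a computed matrix need not be symmetric; this is
    the symmetric matrix that is actually factored. *)
Definition symmx n (D : 'M[R]_n) : 'M[R]_n :=
  \matrix_(a, b) if (a <= b)%N then D a b else D b a.

Lemma symmx_tr n (D : 'M[R]_n) : (symmx D)^T = symmx D.
Proof. by apply/matrixP => a b; rewrite !mxE; case: ltngtP => // /val_inj ->. Qed.

Lemma symmx_dist n (D G : 'M[R]_n) : G^T = G ->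
  onorm (symmx D - G) <= 2 * onorm (D - G).
Proof.
move=> sG; have -> : 2 * onorm (D - G) = onorm (D - G) + onorm (D - G)^T.
  by rewrite onormT; ring.
rewrite /onorm -big_split /=; apply: ler_sum => a _.
rewrite -big_split /=; apply: ler_sum => b _.
rewrite [(D - G)^T _ _]mxE !addmxE !oppmxE [symmx _ _ _]mxE; case: ifP => _.
  by rewrite lerDl.
have Gab : G a b = G b a by rewrite -[in LHS]sG mxE.
by rewrite [in leLHS]Gab lerDr.
Qed.

Lemma fl_chol_symmx n e (D Y : 'M[R]_n) : fl_chol e D Y -> fl_chol e (symmx D) Y.
Proof.
move=> [Yt h]; split => // i j ij; have := h i j ij.
by have -> : symmx D i j = D i j by rewrite mxE ij.
Qed.

(** Write [Q *m T] as [B + E] and expand the Gram matrix of [B]. Each term on the right contains a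
    rounding error or [1%:M - Qp^T *m Qp]. *)
Lemma orth_error_eq m r q (Qp : 'M[R]_(m, r)) (V Q : 'M[R]_(m, q)) (Y : 'M[R]_(r, q))
    (T : 'M[R]_q) :
  let E := Q *m T - (V - Qp *m Y) in let Z := Qp^T *m V - Y in
  let B := V - Qp *m Y in
  T^T *m (Q^T *m Q - 1%:M) *m T =
    - (Z^T *m Y) - Y^T *m Z - Y^T *m (1%:M - Qp^T *m Qp) *m Y
    - (T^T *m T - (V^T *m V - Y^T *m Y))
    + (E^T *m B + B^T *m E + E^T *m E).
Proof.
move=> E Z B.
have -> : T^T *m (Q^T *m Q - 1%:M) *m T = (E + B)^T *m (E + B) - T^T *m T.
  rewrite /E /B subrK mulmxBr mulmxBl mulmx1 trmx_mul !mulmxA.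
  by [].
rewrite /Z; have -> : (E + B)^T *m (E + B) = E^T *m E + E^T *m B + B^T *m E + B^T *m B.
  rewrite [(E + B)^T]linearD /= mulmxDl !mulmxDr.
  by apply/matrixP => i j; rewrite !(addmxE, oppmxE); ring.
have -> : B^T *m B = V^T *m V - V^T *m Qp *m Y - Y^T *m Qp^T *m V + Y^T *m Qp^T *m Qp *m Y.
  rewrite /B [(V - _)^T]linearB /= trmx_mul mulmxBl !mulmxBr !mulmxA.
  by apply/matrixP => i j; rewrite !(addmxE, oppmxE); ring.
rewrite [(_ - Y)^T]linearB /= trmx_mul trmxK.
rewrite !(mulmxBl, mulmxBr) !mulmxA ?mulmx1 ?mul1mx.
by apply/matrixP => i j; rewrite !(addmxE, oppmxE); ring.
Qed.

Lemma cross_error_eq m r q (Qp : 'M[R]_(m, r)) (V Q : 'M[R]_(m, q)) (Y : 'M[R]_(r, q))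
    (T : 'M[R]_q) :
  Qp^T *m Q *m T = (Qp^T *m V - Y) + (1%:M - Qp^T *m Qp) *m Y
    + Qp^T *m (Q *m T - (V - Qp *m Y)).
Proof.
rewrite !(mulmxBl, mulmxBr) !mulmxA mul1mx.
by apply/matrixP => i j; rewrite !(addmxE, oppmxE); ring.
Qed.

End StepLemmas.

(** * Domination up to a constant along a filter *)

Section Domination.
Variables (R : realType) (I : Type) (F : set_system I).
Context {FF : Filter F}.
Implicit Types f g h : I -> R.

(** The constant is common to all indices, as the O-constants of the statement must be. *)
Definition dom f g := exists2 C : R, 0 <= C & \forall i \near F, f i <= C * g i.

Lemma dom_refl f : dom f f.
Proof. by exists 1 => //; near=> i; rewrite mul1r. Unshelve. all: by end_near. Qed.

Lemma domW f g f' g' : dom f g -> (\forall i \near F, f' i <= f i) ->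
  (\forall i \near F, g i <= g' i) -> dom f' g'.
Proof.
move=> [C C0 h] hf hg; exists C => //; near=> i.
apply: (@le_trans _ _ (f i)); first by near: i.
apply: (@le_trans _ _ (C * g i)); first by near: i.
by apply: ler_wpM2l => //; near: i.
Unshelve. all: by end_near. Qed.

Lemma domD f g h : dom f h -> dom g h -> dom (fun i => f i + g i) h.
Proof.
move=> [C C0 hC] [D D0 hD]; exists (C + D); first exact: addr_ge0.
by near=> i; rewrite mulrDl lerD //; near: i.
Unshelve. all: by end_near. Qed.

Lemma domM f1 f2 g1 g2 : (forall i, 0 <= f1 i) -> (forall i, 0 <= f2 i) ->
  dom f1 g1 -> dom f2 g2 -> dom (fun i => f1 i * f2 i) (fun i => g1 i * g2 i).
Proof.
move=> f10 f20 [C C0 hC] [D D0 hD]; exists (C * D); first exact: mulr_ge0.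
by near=> i; rewrite mulrACA ler_pM //; near: i.
Unshelve. all: by end_near. Qed.

Lemma domZ c f g : 0 <= c -> dom f g -> dom (fun i => c * f i) g.
Proof.
move=> c0 [C C0 hC]; exists (c * C); first exact: mulr_ge0.
by near=> i; rewrite -mulrA ler_wpM2l //; near: i.
Unshelve. all: by end_near. Qed.

Lemma dom_cst f c : (\forall i \near F, f i <= c) -> dom f (fun=> 1).
Proof.
move=> h; exists `|c| => //; near=> i; rewrite mulr1 (le_trans _ (ler_norm c)) //.
by near: i.
Unshelve. all: by end_near. Qed.

(** The constant [C + 1] dominates a square root of [C] without introducing one. *)
Lemma dom_sqr f g : (forall i, 0 <= g i) ->
  dom (fun i => f i ^+ 2) (fun i => g i ^+ 2) -> dom f g.
Proof.
move=> g0 [C C0 hC]; exists (C + 1); first exact: addr_ge0.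
near=> i; apply: (le_trans (ler_norm _)); apply: ler_norm_sqr.
  by rewrite mulr_ge0 // addr_ge0.
apply: (@le_trans _ _ (C * g i ^+ 2)); first by near: i.
rewrite exprMn ler_wpM2r ?sqr_ge0 // sqrrD1; have := sqr_ge0 C; lra.
Unshelve. all: by end_near. Qed.

(** As [h] tends to 0, any prescribed constant is eventually reached. The denominator [C + 1] allows
    for [C = 0]. *)
Lemma dom_small h f g : (forall c, 0 < c -> \forall i \near F, h i <= c) ->
  (forall i, 0 <= g i) -> dom f (fun i => h i * g i) ->
  forall c, 0 < c -> \forall i \near F, f i <= c * g i.
Proof.
move=> h0 g0 [C C0 hC] c c_gt0; near=> i.
apply: (@le_trans _ _ (C * (h i * g i))); first by near: i.
rewrite mulrA; apply: ler_wpM2r => //.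
have hi : h i <= c / (C + 1) by near: i; apply: h0; rewrite divr_gt0 // ltr_wpDl.
apply: (le_trans (ler_wpM2l C0 hi)).
rewrite mulrCA ler_piMr ?(ltW c_gt0) // ler_pdivrMr ?ltr_wpDl //; lra.
Unshelve. all: by end_near. Qed.

Lemma dom_mxD m n (A B : I -> 'M[R]_(m, n)) g :
  dom (fun i => onorm (A i)) g -> dom (fun i => onorm (B i)) g ->
  dom (fun i => onorm (A i + B i)) g.
Proof.
by move=> hA hB; apply: (domW (domD hA hB)); near=> i; rewrite // onormD.
Unshelve. all: by end_near. Qed.

Lemma dom_mxN m n (A : I -> 'M[R]_(m, n)) g :
  dom (fun i => onorm (A i)) g -> dom (fun i => onorm (- A i)) g.
Proof. by move=> hA; apply: (domW hA); near=> i; rewrite // onormN.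
Unshelve. all: by end_near. Qed.

Lemma dom_mxT m n (A : I -> 'M[R]_(m, n)) g :
  dom (fun i => onorm (A i)) g -> dom (fun i => onorm (A i)^T) g.
Proof. by move=> hA; apply: (domW hA); near=> i; rewrite // onormT.
Unshelve. all: by end_near. Qed.

Lemma dom_mxM m n q (A : I -> 'M[R]_(m, n)) (B : I -> 'M[R]_(n, q)) g h :
  dom (fun i => onorm (A i)) g -> dom (fun i => onorm (B i)) h ->
  dom (fun i => onorm (A i *m B i)) (fun i => g i * h i).
Proof.
move=> hA hB; apply: (domW (domM _ _ hA hB)) => [i|i||]; try exact: onorm_ge0.
  by near=> i; exact: onormM.
by near=> i.
Unshelve. all: by end_near. Qed.

Lemma dom_nM m n p q (A : I -> 'M[R]_(m, n)) (B : I -> 'M[R]_(p, q)) g h :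
  dom (fun i => onorm (A i)) g -> dom (fun i => onorm (B i)) h ->
  dom (fun i => onorm (A i) * onorm (B i)) (fun i => g i * h i).
Proof. by apply: domM => i; exact: onorm_ge0. Qed.

Lemma dom_eq f f' g : dom f g -> f' =1 f -> dom f' g.
Proof. by move=> h /funext ->. Qed.

End Domination.

(** * Error bounds for one pass, uniform over the runs *)

Section Step.
Variables (R : realType) (I : Type) (F : set_system I).
Context {FF : Filter F}.
Variables (e s k : I -> R).
Hypotheses (e0 : forall i, 0 <= e i) (s0 : forall i, 0 < s i) (k1 : forall i, 1 <= k i).
Hypothesis small : forall c, 0 < c -> \forall i \near F, e i * k i ^+ 3 <= c.
Local Notation "\dom_ i f <~ g" := (dom F (fun i => f) (fun i => g))
  (at level 70, i name, f at level 69, g at level 69).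

Local Notation mxD := (@dom_mxD R I F FF _ _ _ _ _).
Local Notation mxN := (@dom_mxN R I F FF _ _ _ _).
Local Notation mxT := (@dom_mxT R I F FF _ _ _ _).
Local Notation mxM := (@dom_mxM R I F FF _ _ _ _ _ _ _).

(** The chain follows from [k >= 1] and serves to compare every error term with the required one. *)
Let powers i := [/\ [/\ 0 <= e i, e i <= e i * k i, e i * k i <= e i * k i ^+ 2 &
     e i * k i ^+ 2 <= e i * k i ^+ 3], e i * k i ^+ 3 <= 1, 0 < s i, 1 <= k i & 0 <= k i].

Let near_powers : \forall i \near F, powers i.
Proof.
apply: filterS (small ltr01) => i h; have k0 : 0 <= k i by have := k1 i; lra.
split=> //; split=> //; rewrite ?exprS ?expr0 ?mulr1 ?mulrA ler_peMr // ?mulr_ge0 //.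
Qed.

Let domE (f g f' g' : I -> R) : dom F f g ->
  (forall i, 0 <= e i -> e i <= 1 -> f' i <= f i) ->
  (forall i, powers i -> g i <= g' i) -> dom F f' g'.
Proof.
move=> h hf hg; apply: (domW h); apply: filterS near_powers => i; last exact: hg.
by move=> [[e_ge0 ? ? ?] ? _ _ _]; apply: hf => //; lra.
Qed.

Let near_small (f g : I -> R) c : (forall i, 0 <= g i) ->
  \dom_ i f i <~ e i * k i ^+ 3 * g i -> 0 < c -> \forall i \near F, f i <= c * g i.
Proof. by move=> g0 h; apply: dom_small h c. Qed.

(** In the application, the largest singular value of the whole matrix; all sizes are expressed in
    this unit. *)
Let x i : R := k i * s i.
Let x0 i : 0 <= x i. Proof. by rewrite mulr_ge0 ?(ltW (s0 i)) // (le_trans ler01). Qed.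

Let e_x i : powers i -> e i * x i <= x i.
Proof. by move=> [[? ? ? ?] ? ? ? ?]; rewrite ler_piMl ?x0 //; lra. Qed.

Let ek2_x i : powers i -> e i * x i <= e i * k i ^+ 2 * x i.
Proof. by move=> [[? ? ? ?] ? ? ? ?]; rewrite ler_wpM2r ?x0 //; lra. Qed.

Let ek2_x1 i : powers i -> e i * k i ^+ 2 * x i <= x i.
Proof. by move=> [[? ? ? ?] ? ? ? ?]; rewrite ler_piMl ?x0 //; lra. Qed.

Let e_x2 i : powers i -> e i * x i ^+ 2 <= x i ^+ 2.
Proof. by move=> [[? ? ? ?] ? ? ? ?]; rewrite ler_piMl ?sqr_ge0 //; lra. Qed.

Let domr (f g g' : I -> R) : dom F f g ->
  (forall i, powers i -> g i <= g' i) -> dom F f g'.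
Proof. by move=> h hg; apply: (domE h). Qed.

Let dom_err (E f g : I -> R) c : 0 <= c -> (forall i, 0 <= f i) -> dom F f g ->
  (forall i, 0 <= e i -> e i <= 1 -> E i <= c * e i * f i) ->
  \dom_ i E i <~ e i * g i.
Proof.
move=> c0 f0 hf hE; apply: (domE (domM _ f0 (domZ c0 (dom_refl e)) hf)) => //.
by move=> i; rewrite mulr_ge0.
Qed.

Variables (m r q : nat).
Variables (Qp Xp : I -> 'M[R]_(m, r)) (Tp : I -> 'M[R]_r).
Variables (X Q : I -> 'M[R]_(m, q)) (Rp : I -> 'M[R]_(r, q)) (T : I -> 'M[R]_q).
(** Data of the induction: a gain for all columns up to the current ones, and the residual and loss
    of orthogonality of the preceding ones. *)
Hypothesis gain : forall i z y,
  s i ^+ 2 * (sqn z + sqn y) <= sqn (Xp i *m z + X i *m y).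
Hypothesis dX : \dom_ i onorm (X i) <~ k i * s i.
Hypothesis dRes : \dom_ i onorm (Qp i *m Tp i - Xp i) <~ e i * (k i * s i).
Hypothesis dOrt : \dom_ i onorm (1%:M - (Qp i)^T *m Qp i) <~ e i * k i ^+ 2.
Variables (S Y : I -> 'M[R]_(r, q)) (V W : I -> 'M[R]_(m, q)) (Omega D : I -> 'M[R]_q).
Hypothesis hS : forall i, fl_mulmx (e i) (Qp i)^T (X i) (S i).
Hypothesis hV : forall i, fl_submulmx (e i) (X i) (Qp i) (S i) (V i).
Hypothesis hY : forall i, fl_mulmx (e i) (row_mx (Qp i) (V i))^T (V i) (col_mx (Y i) (Omega i)).
Hypothesis hD : forall i, fl_submulmx (e i) (Omega i) (Y i)^T (Y i) (D i).
Hypothesis hT : forall i, fl_chol (e i) (D i) (T i).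
Hypothesis hW : forall i, fl_submulmx (e i) (V i) (Qp i) (Y i) (W i).
Hypothesis hQ : forall i, fl_trsolve (e i) (W i) (T i) (Q i).
Hypothesis hR : forall i, fl_addmx (e i) (S i) (Y i) (Rp i).

Let c2 n : 0 <= 2 ^+ n :> R. Proof. by rewrite exprn_ge0. Qed.

Let dQp : \dom_ i onorm (Qp i) <~ 1.
Proof.
apply: (@dom_cst _ _ _ _ _ ((m * r)%:R * 2)).
have : \forall i \near F, onorm (1%:M - (Qp i)^T *m Qp i) <= 1 * 1.
  apply: (near_small (g := fun=> 1)) => //.
  by apply: (domE dOrt) => // i [[? ? ? ?] ? ? ? ?]; lra.
by apply: filterS => i; rewrite mulr1; exact: onorm_orth.
Qed.

Let nn m1 n1 m2 n2 (A : 'M[R]_(m1, n1)) (B : 'M[R]_(m2, n2)) : 0 <= onorm A * onorm B.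
Proof. by rewrite mulr_ge0 ?onorm_ge0. Qed.

Let dQpM n (B : I -> 'M[R]_(r, n)) g : dom F (fun i => onorm (B i)) g ->
  \dom_ i onorm (Qp i *m B i) <~ g i.
Proof. by move=> h; apply: (domr (mxM dQp h)) => i _; rewrite mul1r. Qed.

Let dQpTM n (B : I -> 'M[R]_(m, n)) g : dom F (fun i => onorm (B i)) g ->
  \dom_ i onorm ((Qp i)^T *m B i) <~ g i.
Proof. by move=> h; apply: (domr (mxM (mxT dQp) h)) => i _; rewrite mul1r. Qed.

Let dS1 : \dom_ i onorm (S i - (Qp i)^T *m X i) <~ e i * x i.
Proof.
apply: (domr (dom_err (c2 m.+1) _ (dom_nM (mxT dQp) dX) _)) => [i|i|i _].
- exact: nn.
- by move=> h1 h2; exact: fl_mulmx_err.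
- by rewrite mul1r.
Qed.

Let dS : \dom_ i onorm (S i) <~ x i.
Proof.
by apply: (dom_eq (mxD (domr dS1 e_x) (dQpTM dX))) => i; rewrite subrK.
Qed.

Let dV1 : \dom_ i onorm (V i - (X i - Qp i *m S i)) <~ e i * x i.
Proof.
have h : \dom_ i onorm (X i) + onorm (Qp i) * onorm (S i) <~ x i.
  by apply: domD dX (domr (dom_nM dQp dS) _) => i _; rewrite mul1r.
apply: (domr (dom_err (c2 r.+2) _ h _)) => [i|i|//].
- by rewrite addr_ge0 ?nn ?onorm_ge0.
- by move=> h1 h2; exact: fl_submulmx_err.
Qed.

Let dV : \dom_ i onorm (V i) <~ x i.
Proof.
have h := mxD dX (mxN (dQpM dS)).
by apply: (dom_eq (mxD (domr dV1 e_x) h)) => i; rewrite subrK.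
Qed.

(** [Qp^T (X - Qp S)] is [(I - Qp^T Qp) S] minus the error of [S]: the loss of orthogonality of [Qp]
    limits the effect of the first projection. *)
Let dQV : \dom_ i onorm ((Qp i)^T *m V i) <~ e i * k i ^+ 2 * x i.
Proof.
have h1 := mxM dOrt dS.
have h2 := mxN (domr dS1 ek2_x).
have h3 := dQpTM (domr dV1 ek2_x).
apply: (dom_eq (mxD (mxD h1 h2) h3)) => i.
rewrite !(mulmxBl, mulmxBr) mul1mx !mulmxA.
by congr onorm; apply/matrixP => a b; rewrite !(addmxE, oppmxE); ring.
Qed.

Let hY1 i : fl_mulmx (e i) (Qp i)^T (V i) (Y i). Proof. by have [] := fl_mulmx_row (hY i). Qed.
Let hO i : fl_mulmx (e i) (V i)^T (V i) (Omega i). Proof. by have [] := fl_mulmx_row (hY i). Qed.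

Let dY1 : \dom_ i onorm ((Qp i)^T *m V i - Y i) <~ e i * x i.
Proof.
apply: (domr (dom_err (c2 m.+1) _ (dom_nM (mxT dQp) dV) _)) => [i|i|i _].
- exact: nn.
- by move=> h1 h2; rewrite onorm_distC; exact: fl_mulmx_err.
- by rewrite mul1r.
Qed.

Let dY : \dom_ i onorm (Y i) <~ e i * k i ^+ 2 * x i.
Proof.
apply: (dom_eq (mxD (mxN (domr dY1 ek2_x)) dQV)) => i.
by rewrite opprB subrK.
Qed.

Let dYx : \dom_ i onorm (Y i) <~ x i. Proof. exact: domr dY ek2_x1. Qed.

Let dO1 : \dom_ i onorm (Omega i - (V i)^T *m V i) <~ e i * x i ^+ 2.
Proof.
apply: (domr (dom_err (c2 m.+1) _ (dom_nM (mxT dV) dV) _)) => [i|i|i _].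
- exact: nn.
- by move=> h1 h2; exact: fl_mulmx_err.
- by rewrite expr2.
Qed.

Let dO : \dom_ i onorm (Omega i) <~ x i ^+ 2.
Proof.
have h : \dom_ i onorm ((V i)^T *m V i) <~ x i ^+ 2.
  by apply: (domr (mxM (mxT dV) dV)) => i _; rewrite expr2.
by apply: (dom_eq (mxD (domr dO1 e_x2) h)) => i; rewrite subrK.
Qed.

Let G i : 'M[R]_q := (V i)^T *m V i - (Y i)^T *m Y i.

Let G_tr i : (G i)^T = G i.
Proof. by rewrite /G linearB /= !trmx_mul !trmxK. Qed.

Let dG : \dom_ i onorm (G i) <~ x i ^+ 2.
Proof.
have h := mxD (mxM (mxT dV) dV) (mxN (mxM (mxT dYx) dYx)).
by apply: (domr h) => i _; rewrite expr2.
Qed.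

Let dD : \dom_ i onorm (D i - G i) <~ e i * x i ^+ 2.
Proof.
have h : \dom_ i onorm (Omega i) + onorm (Y i)^T * onorm (Y i) <~ x i ^+ 2.
  by apply: domD dO (domr (dom_nM (mxT dYx) dYx) _) => i _; rewrite expr2.
have h1 : \dom_ i onorm (D i - (Omega i - (Y i)^T *m Y i)) <~ e i * x i ^+ 2.
  apply: (domr (dom_err (c2 r.+2) _ h _)) => [i|i|//].
  - by rewrite addr_ge0 ?nn ?onorm_ge0.
  - by move=> h1 h2; exact: fl_submulmx_err.
apply: (dom_eq (mxD h1 dO1)) => i; congr onorm.
by rewrite /G; apply/matrixP => a b; rewrite !(addmxE, oppmxE); ring.
Qed.

Let A i : 'M[R]_q := symmx (D i).

Let dA1 : \dom_ i onorm (A i - G i) <~ e i * x i ^+ 2.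
Proof.
have h : \dom_ i 2 * onorm (D i - G i) <~ e i * x i ^+ 2.
  exact: domZ (ler0n R 2) dD.
by apply: (domE h) => // i _ _; exact: symmx_dist.
Qed.

Let dA : \dom_ i onorm (A i) <~ x i ^+ 2.
Proof. by apply: (dom_eq (mxD (domr dA1 e_x2) dG)) => i; rewrite subrK. Qed.

Let s_ge0 i : 0 <= s i. Proof. exact: ltW. Qed.
Let s2_ge0 i : 0 <= s i ^+ 2. Proof. exact: sqr_ge0. Qed.

Let ex_s i : powers i -> e i * x i <= e i * k i ^+ 3 * s i.
Proof.
by move=> [[? ? ? ?] ? ? ? ?]; rewrite /x mulrA ler_wpM2r //; lra.
Qed.

Let ex2_s2 i : powers i -> e i * x i ^+ 2 <= e i * k i ^+ 3 * s i ^+ 2.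
Proof.
by move=> [[? ? ? ?] ? ? ? ?]; rewrite /x exprMn mulrA ler_wpM2r.
Qed.

Let near_V : \forall i \near F, forall y, s i ^+ 2 * sqn y <= 4 * sqn (V i *m y).
Proof.
have h4 : 0 < 4^-1 :> R by rewrite invr_gt0.
have h1 := near_small s_ge0 (domr dRes ex_s) h4.
have h2 := near_small s_ge0 (domr dV1 ex_s) h4.
apply: filterS2 h1 h2 => i; rewrite mulrC => h1 h2.
exact: projected_gain (s0 i) (gain i) h1 h2.
Qed.

Let near_A : \forall i \near F, forall y, sqn (V i *m y) <= 2 * bil (A i) y y.
Proof.
have h4 : 0 < 4^-1 :> R by rewrite invr_gt0.
have h16 : 0 < 16^-1 :> R by rewrite invr_gt0.
(* Both sides are equal: the cube in the smallness hypothesis makes [Y] small relative to the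
   smallest gain of [V]. *)
have hx i : powers i -> e i * k i ^+ 2 * x i <= e i * k i ^+ 3 * s i.
  by move=> _; rewrite /x mulrA -(mulrA (e i)) -exprSr.
have h1 := near_small s_ge0 (domr dY hx) h4.
have h2 := near_small s2_ge0 (domr dA1 ex2_s2) h16.
apply: filterS3 near_V h1 h2 => i hV'; rewrite mulrC => h1; rewrite mulrC => h2.
exact: corrected_gram_gain (s0 i) hV' h1 h2.
Qed.

Let near_chol : exists2 g, 0 <= g & \forall i \near F,
  (forall j, 0 < T i j j) /\ onorm ((T i)^T *m T i - A i) <= g * e i * onorm (A i).
Proof.
have [c cE] : exists c : R, c = 2 ^+ q.+4 + 3 by exists (2 ^+ q.+4 + 3).
have [g gE] : exists g : R, g = 3 * (q * q)%:R * c by exists (3 * (q * q)%:R * c).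
have g0 : 0 <= g by rewrite gE cE !mulr_ge0 // addr_ge0.
exists g => //.
(* Bounding [e * k ^+ 3] by this number will give [20 * g * e <= 1]; the summand 1 covers
   [g = 0]. *)
have h20 : 0 < (20 * g + 1)^-1 by rewrite invr_gt0 ltr_wpDl // mulr_ge0.
have h8 : 0 < 8^-1 :> R by rewrite invr_gt0.
have h1 : \forall i \near F, 20 * g * e i * onorm (A i) <= 8^-1 * s i ^+ 2.
  apply: near_small => //.
  apply: (domr (dom_err (c := 20 * g) _ _ dA _)) => [|i|//|//].
  - by rewrite mulr_ge0.
  - exact: onorm_ge0.
apply: filterS2 (filterI near_A near_V) (filterI h1 (filterI near_powers (small h20))).
move=> i [hA hV'] [h1i [[[? ? ? ?] ? ? ? ?] hei]].
have he : 20 * g * e i <= 1.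
  have h : e i <= (20 * g + 1)^-1 by lra.
  apply: (le_trans (ler_wpM2l _ h)); first by rewrite mulr_ge0.
  rewrite ler_pdivrMr ?ltr_wpDl ?mulr_ge0 //; lra.
have s2 : 0 < s i ^+ 2 by rewrite exprn_gt0.
(* The definiteness constant [s ^+ 2 / 8] combines the factor 4 of [near_V] with the factor 2 of
   [near_A]. *)
apply: (@fl_chol_err _ _ c g _ (8^-1 * s i ^+ 2)) => //.
- by lra.
- exact: symmx_tr.
- by move=> w; have := hA w; have := hV' w; lra.
- by move=> a b; exact: ler_entry_onorm.
- by rewrite mulr_gt0.
- exact: fl_chol_symmx.
Qed.

Let near_pivots : \forall i \near F, forall j, 0 < T i j j.
Proof. by have [g _] := near_chol; apply: filterS => i []. Qed.

Let dTA : \dom_ i onorm ((T i)^T *m T i - A i) <~ e i * x i ^+ 2.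
Proof.
have [g g0 hg] := near_chol.
apply: (domW (domM _ _ (domZ g0 (dom_refl e)) dA)).
- by move=> i; rewrite mulr_ge0.
- by move=> i; exact: onorm_ge0.
- by apply: filterS hg => i [].
- by near=> i.
Unshelve. all: by end_near. Qed.

Let dTG : \dom_ i onorm ((T i)^T *m T i - G i) <~ e i * x i ^+ 2.
Proof.
apply: (dom_eq (mxD dTA dA1)) => i; congr onorm.
by apply/matrixP => a b; rewrite !(addmxE, oppmxE); ring.
Qed.

Let dT : \dom_ i onorm (T i) <~ x i.
Proof.
have h : \dom_ i onorm ((T i)^T *m T i) <~ x i ^+ 2.
  by apply: (dom_eq (mxD (domr dTG e_x2) dG)) => i; rewrite subrK.
apply: dom_sqr => //; apply: (domE (domZ (c := (q * q)%:R ^+ 2) _ h)) => // i _ _.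
have -> : (q * q)%:R ^+ 2 * onorm ((T i)^T *m T i)
    = ((q * q)%:R * Num.sqrt (onorm ((T i)^T *m T i))) ^+ 2.
  by rewrite exprMn sqr_sqrtr ?onorm_ge0.
rewrite lerXn2r ?nnegrE ?onorm_ge0 ?mulr_ge0 ?sqrtr_ge0 //.
apply: onorm_le => a b; rewrite -sqrtr_sqr ler_sqrt ?onorm_ge0 //.
apply: (le_trans (sqr_entry_gram _ a b)); apply: (le_trans (ler_norm _)).
exact: ler_entry_onorm.
Qed.

Let near_T : \forall i \near F, [/\ T i \in unitmx,
  forall y, sqn (V i *m y) <= 4 * sqn (T i *m y) &
  forall y, s i ^+ 2 * sqn y <= 16 * sqn (T i *m y)].
Proof.
have h16 : 0 < 16^-1 :> R by rewrite invr_gt0.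
have h2 := near_small s2_ge0 (domr dTA ex2_s2) h16.
apply: filterS3 near_V near_A h2 => i hV' hA; rewrite mulrC => h2.
have h3 := cholesky_gain (s0 i) hV' hA h2.
have h4 y : s i ^+ 2 * sqn y <= 16 * sqn (T i *m y).
  by have := h3 y; have := hV' y; lra.
by split => //; apply: unitmx_gain h4; rewrite exprn_gt0.
Qed.

Let Ti i := invmx (T i).

Let dTi : \dom_ i onorm (Ti i) <~ (s i)^-1.
Proof.
exists ((q * q)%:R * 4) => //.
apply: filterS near_T => i [Tu _ hT2]; rewrite -mulrA.
apply: onorm_le_gain => [|y]; first by rewrite mulr_ge0 // invr_ge0.
have := hT2 (Ti i *m y); rewrite mulKVmx // => h.
have s2 : 0 < s i ^+ 2 by rewrite exprn_gt0.
rewrite exprMn exprVn mulrAC ler_pdivlMr //; lra.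
Qed.

(** Separate bounds on [V] and [Ti] would only give [k]; comparing the gains of [V] and [T] gives a
    constant. *)
Let dVTi : \dom_ i onorm (V i *m Ti i) <~ 1.
Proof.
apply: (@dom_cst _ _ _ _ _ ((m * q)%:R * 2)).
apply: filterS near_T => i [Tu hT1 _].
apply: onorm_le_gain => // y.
have := hT1 (Ti i *m y); rewrite mulKVmx // mulmxA; lra.
Qed.

Let dW1 : \dom_ i onorm (W i - (V i - Qp i *m Y i)) <~ e i * x i.
Proof.
have h : \dom_ i onorm (V i) + onorm (Qp i) * onorm (Y i) <~ x i.
  by apply: domD dV (domr (dom_nM dQp dYx) _) => i _; rewrite mul1r.
apply: (domr (dom_err (c2 r.+2) _ h _)) => [i|i|//].
- by rewrite addr_ge0 ?nn ?onorm_ge0.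
- by move=> h1 h2; exact: fl_submulmx_err.
Qed.

Let dQpY : \dom_ i onorm (Qp i *m Y i) <~ e i * k i ^+ 2 * x i.
Proof. exact: dQpM dY. Qed.

Let dB : \dom_ i onorm (V i - Qp i *m Y i) <~ x i.
Proof. exact: mxD dV (mxN (domr dQpY ek2_x1)). Qed.

Let dW : \dom_ i onorm (W i) <~ x i.
Proof. by apply: (dom_eq (mxD (domr dW1 e_x) dB)) => i; rewrite subrK. Qed.

Let E i : 'M[R]_(m, q) := Q i *m T i - (V i - Qp i *m Y i).

(** The error of the triangular solve is proportional to [Q], whose size is not known yet. *)
Let dE1 : \dom_ i onorm (E i) <~ e i * x i * (1 + onorm (Q i)).
Proof.
have c0 : 0 <= 2 ^+ q.+3 + 1 :> R by rewrite addr_ge0.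
have Q1 i : 0 <= 1 + onorm (Q i) by rewrite addr_ge0 ?onorm_ge0.
have h : \dom_ i onorm (W i) + onorm (Q i) * onorm (T i) <~ x i * (1 + onorm (Q i)).
  apply: domD; [apply: (domr dW)|apply: (domr (dom_nM (dom_refl _) dT))] => i _.
    by rewrite ler_peMr // lerDl onorm_ge0.
  by rewrite mulrC ler_wpM2l // lerDr.
have h1 : \dom_ i onorm (Q i *m T i - W i) <~ e i * x i * (1 + onorm (Q i)).
  apply: (domW (domM _ _ (domZ c0 (dom_refl e)) h)).
  - by move=> i; rewrite mulr_ge0.
  - by move=> i; rewrite addr_ge0 ?nn ?onorm_ge0.
  - apply: filterS2 near_pivots near_powers => i Tp0 [[? ? ? ?] ? ? ? ?].
    apply: fl_trsolve_err => //; first by lra.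
      by have [+ _] := hT i; apply.
    by move=> j; exact: lt0r_neq0.
  - by near=> i; rewrite mulrA.
have h2 : \dom_ i onorm (W i - (V i - Qp i *m Y i)) <~ e i * x i * (1 + onorm (Q i)).
  apply: (domr dW1) => i _.
  by rewrite ler_peMr ?lerDl ?onorm_ge0 // mulr_ge0.
by apply: (dom_eq (mxD h1 h2)) => i; rewrite addrA subrK.
Unshelve. all: by end_near. Qed.

(** [Q] is [V Ti - Qp Y Ti + E Ti], where the last term is at most half of [1 + onorm Q] and is
    absorbed on the left. *)
Let dQ : \dom_ i onorm (Q i) <~ 1.
Proof.
have Q1 i : 0 <= 1 + onorm (Q i) by rewrite addr_ge0 ?onorm_ge0.
have h1 : \dom_ i onorm (Qp i *m Y i *m Ti i) <~ 1.
  apply: (domr (mxM dQpY dTi)) => i [[? ? ? ?] h ? ? ?].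
  rewrite /x mulrA mulfK ?lt0r_neq0 //.
  by rewrite -(mulrA (e i)) -exprSr.
have h2 : \forall i \near F, onorm (E i *m Ti i) <= 2^-1 * (1 + onorm (Q i)).
  apply: near_small => //; apply: (domr (mxM dE1 dTi)) => i [[? ? ? ?] ? ? ? ?].
  rewrite mulrAC; apply: ler_wpM2r => //.
  rewrite /x mulrA mulfK ?lt0r_neq0 //; lra.
have [C C0 hC] := mxD dVTi (mxN h1).
exists (2 * C + 1); first by rewrite addr_ge0 // mulr_ge0.
apply: filterS3 near_T h2 hC => i [Tu _ _] h3 h4.
have : onorm (Q i) <= onorm (V i *m Ti i - Qp i *m Y i *m Ti i) + onorm (E i *m Ti i).
  apply: le_trans (onormD _ _); rewrite -mulmxBl -mulmxDl /E.
  by rewrite addrC subrK mulmxK.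
lra.
Qed.

Let dE : \dom_ i onorm (E i) <~ e i * x i.
Proof.
have h : \dom_ i 1 + onorm (Q i) <~ 1 by apply: domD dQ; exact: dom_refl.
have Q1 i : 0 <= 1 + onorm (Q i) by rewrite addr_ge0 ?onorm_ge0.
have ex0 i : 0 <= e i * x i by rewrite mulr_ge0.
have [C C0 hC] := dE1; have [C' C'0 hC'] := h.
exists (C * C'); first exact: mulr_ge0.
apply: filterS2 hC hC' => i h1 h2; apply: (le_trans h1).
rewrite -[C * C' * _]mulrA; apply: ler_wpM2l => //; rewrite mulrC.
by apply: ler_wpM2r => //; rewrite mulr1 in h2.
Qed.

(** The exact parts telescope: [Qp Y] is subtracted from [V] and returns through [Rp], so only
    rounding errors remain. *)
Lemma step_residual : \dom_ i onorm (Qp i *m Rp i + Q i *m T i - X i) <~ e i * (k i * s i).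
Proof.
have h : \dom_ i onorm (S i) + onorm (Y i) <~ x i by exact: domD.
have h1 : \dom_ i onorm (Rp i - (S i + Y i)) <~ e i * x i.
  apply: (dom_err ler01 _ h) => [i|i ? ?]; first by rewrite addr_ge0 ?onorm_ge0.
  by rewrite mul1r; exact: fl_addmx_err.
have h2 : \dom_ i onorm (Qp i *m (Rp i - (S i + Y i))) <~ e i * x i.
  exact: dQpM h1.
apply: (dom_eq (mxD (mxD h2 dE) dV1)) => i; congr onorm.
rewrite /E !(mulmxBr, mulmxDr).
by apply/matrixP => a b; rewrite !(addmxE, oppmxE); ring.
Qed.

(** The inverse of [T] has size [s^-1], while every term of [cross_error_eq] is of order
    [e k^2 s]. *)
Lemma step_cross : \dom_ i onorm ((Qp i)^T *m Q i) <~ e i * k i ^+ 2.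
Proof.
have h : \dom_ i onorm ((Qp i)^T *m Q i *m T i) <~ e i * k i ^+ 2 * s i.
  have hx i : powers i -> e i * x i <= e i * k i ^+ 2 * s i.
    by move=> [[? ? ? ?] ? ? ? ?]; rewrite /x mulrA ler_wpM2r.
  have h1 : \dom_ i onorm ((1%:M - (Qp i)^T *m Qp i) *m Y i) <~ e i * k i ^+ 2 * s i.
    apply: (domr (mxM dOrt dY)) => i [[? ? ? ?] h ? ? ?].
    have -> : e i * k i ^+ 2 * (e i * k i ^+ 2 * x i)
      = e i * k i ^+ 2 * s i * (e i * k i ^+ 3) by rewrite /x; ring.
    by rewrite ler_piMr // mulr_ge0 //; lra.
  have h2 : \dom_ i onorm ((Qp i)^T *m E i) <~ e i * k i ^+ 2 * s i.
    exact: dQpTM (domr dE hx).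
  apply: (dom_eq (mxD (mxD (domr dY1 hx) h1) h2)) => i; congr onorm.
  exact: cross_error_eq.
apply: (domW (mxM h dTi)).
  by apply: filterS near_T => i [Tu _ _]; rewrite mulmxK.
by near=> i; rewrite mulfK ?lt0r_neq0.
Unshelve. all: by end_near. Qed.

Lemma step_orth : \dom_ i onorm (1%:M - (Q i)^T *m Q i) <~ e i * k i ^+ 2.
Proof.
have h : \dom_ i onorm ((T i)^T *m ((Q i)^T *m Q i - 1%:M) *m T i) <~ e i * x i ^+ 2.
  have dE' : \dom_ i onorm (E i) <~ x i by exact: domr dE e_x.
  have h1 : \dom_ i onorm (((Qp i)^T *m V i - Y i)^T *m Y i) <~ e i * x i ^+ 2.
    by apply: (domr (mxM (mxT dY1) dYx)) => i _; rewrite expr2 mulrA.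
  have h2 : \dom_ i onorm ((Y i)^T *m ((Qp i)^T *m V i - Y i)) <~ e i * x i ^+ 2.
    by apply: (domr (mxM (mxT dYx) dY1)) => i _; rewrite expr2 mulrCA.
  (* Three factors [e k^2] are present, which leaves the spare factor [(e k^3)^2], at most 1. *)
  have h3 : \dom_ i onorm ((Y i)^T *m (1%:M - (Qp i)^T *m Qp i) *m Y i) <~ e i * x i ^+ 2.
    apply: (domr (mxM (mxM (mxT dY) dOrt) dY)) => i [[? ? ? ?] h ? ? ?].
    have -> : e i * k i ^+ 2 * x i * (e i * k i ^+ 2) * (e i * k i ^+ 2 * x i)
      = e i * x i ^+ 2 * (e i * k i ^+ 3) ^+ 2 by ring.
    by rewrite ler_piMr ?exprn_ile1 ?mulr_ge0 ?sqr_ge0 //; lra.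
  have h4 : \dom_ i onorm ((E i)^T *m (V i - Qp i *m Y i)) <~ e i * x i ^+ 2.
    by apply: (domr (mxM (mxT dE) dB)) => i _; rewrite expr2 mulrA.
  have h5 : \dom_ i onorm ((V i - Qp i *m Y i)^T *m E i) <~ e i * x i ^+ 2.
    by apply: (domr (mxM (mxT dB) dE)) => i _; rewrite expr2 mulrCA.
  have h6 : \dom_ i onorm ((E i)^T *m E i) <~ e i * x i ^+ 2.
    by apply: (domr (mxM (mxT dE) dE')) => i _; rewrite expr2 mulrA.
  have h7 := mxD (mxD h4 h5) h6.
  have h8 := mxD (mxN h1) (mxN h2).
  have h9 := mxD (mxD h8 (mxN h3)) (mxN dTG).
  apply: (dom_eq (mxD h9 h7)) => i; congr onorm.
  exact: orth_error_eq.
apply: (domW (mxM (mxM (mxT dTi) h) dTi)).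
  apply: filterS near_T => i [Tu _ _]; rewrite onorm_distC.
  by rewrite !mulmxA -trmx_mul mulmxV // trmx1 mul1mx mulmxK.
(* As [x = k * s], dividing [e * x ^+ 2] by [s ^+ 2] leaves [e * k ^+ 2]. *)
near=> i; rewrite /x exprMn.
have -> : (s i)^-1 * (e i * (k i ^+ 2 * s i ^+ 2)) / s i = e i * k i ^+ 2 * (s i / s i) ^+ 2.
  by rewrite expr_div_n; field; rewrite lt0r_neq0.
by rewrite divff ?lt0r_neq0 // expr1n mulr1.
Unshelve. all: by end_near. Qed.

End Step.

(** * Block columns and induction over the passes *)

Section Blocks.
Variable R : realType.

Lemma onorm_mxsub m n m' n' (f : 'I_m' -> 'I_m) (g : 'I_n' -> 'I_n) (A : 'M[R]_(m, n)) :
  onorm (mxsub f g A) <= (m' * n')%:R * onorm A.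
Proof. by apply: onorm_le => i j; rewrite mxE ler_entry_onorm. Qed.

Lemma onorm_mxrow m p (q_ : 'I_p -> nat) (B : forall b, 'M[R]_(m, q_ b)) :
  onorm (\mxrow_b B b) <= (m * (\sum_b q_ b))%:R * \sum_b onorm (B b).
Proof.
apply: onorm_le => i j; rewrite mxE.
apply: (le_trans (ler_entry_onorm _ _ _)).
rewrite [leRHS](bigD1 (tagnat.sig1 j)) //= lerDl.
by apply: sumr_ge0 => b _; exact: onorm_ge0.
Qed.

Lemma sqn_mxcol p (q_ : 'I_p -> nat) (B : forall b, 'cV[R]_(q_ b)) :
  sqn (\mxcol_b B b) = \sum_b sqn (B b).
Proof.
rewrite sqnE tr_mxcol mul_mxrow_mxcol summxE.
by apply: eq_bigr => b _; rewrite sqnE.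
Qed.

Lemma submxblock1 p w (a b : 'I_p) :
  @submxblock R p p (fun=> w) (fun=> w) 1%:M a b = (a == b)%:R%:M.
Proof.
rewrite -(@mxdiagZ R p (fun=> w) 1); have [<-|ab] := eqVneq a b.
  by rewrite submxblock_diag.
by rewrite /mxdiag mxblockK (negbTE ab) raddf0.
Qed.

Variables (m w p : nat).

Lemma gram_blocks q (B : 'I_q -> 'M[R]_(m, w)) :
  1%:M - (\mxrow_a B a)^T *m (\mxrow_a B a)
  = \mxrow_b \mxcol_a ((a == b)%:R%:M - (B a)^T *m B b) :> 'M[R]_(blockcols q w).
Proof.
rewrite -mxblockEh; apply/mxblockP => a b; rewrite submxblockB submxblock1.
by rewrite tr_mxrow mul_mxcol_mxrow !mxblockK.
Qed.

Lemma mulmx_blocks (Q : 'M[R]_(m, blockcols p w)) (T : 'M[R]_(blockcols p w)) :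
  Q *m T = \mxrow_b \sum_a blkcol Q a *m blk T a b.
Proof. by rewrite -{1}(submxrowK Q) -{1}(submxblockK T) mul_mxrow_mxblock. Qed.

Lemma sum_below (V : nmodType) (F : 'I_p -> V) (j : 'I_p) :
  (forall a : 'I_p, (j < a)%N -> F a = 0) ->
  \sum_a F a = \sum_(a < j) F (below a) + F j.
Proof.
move=> F0; rewrite -(big_ord_narrow (F := F) (ltnW (ltn_ord j))).
rewrite (bigID [pred a : 'I_p | (a < j)%N]) /=; congr (_ + _).
rewrite (bigD1 j) ?ltnn //= big1 ?addr0 // => a /andP[]; rewrite -leqNgt leq_eqVlt.
by move=> /orP[/eqP/val_inj ->|/F0 //]; rewrite eqxx.
Qed.

(** Padding by zero blocks gives a vector for the whole matrix with the same image and the same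
    norm. *)
Lemma gain_prefix (X : 'M[R]_(m, blockcols p w)) c (j : 'I_p)
    (z : 'cV[R]_(\sum_(a < j) w)) (y : 'cV[R]_w) :
  (forall u, c * sqn u <= sqn (X *m u)) ->
  c * (sqn z + sqn y) <= sqn ((\mxrow_(a < j) blkcol X (below a)) *m z + blkcol X j *m y).
Proof.
move=> lo.
pose ub (b : 'I_p) : 'cV[R]_w :=
  if insub (val b) is Some a then @submxcol R j (fun=> w) 1 z a
  else if b == j then y else 0.
have ub_lt (a : 'I_j) : ub (below a) = @submxcol R j (fun=> w) 1 z a.
  by rewrite /ub /= valK.
have ub_j : ub j = y by rewrite /ub insubN ?ltnn // eqxx.
have ub_gt (b : 'I_p) : (j < b)%N -> ub b = 0.
  move=> jb; rewrite /ub insubN -?leqNgt ?(ltnW jb) //.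
  by case: eqP => // bj; rewrite bj ltnn in jb.
have := lo (\mxcol_b ub b); rewrite sqn_mxcol.
rewrite -{1}(submxrowK X) mul_mxrow_mxcol.
rewrite (@sum_below _ (fun b => sqn (ub b)) j); last first.
  by move=> b /ub_gt ->; rewrite /sqn big1 // => i _; rewrite mxE expr0n.
rewrite (@sum_below _ (fun b => blkcol X b *m ub b) j) ?ub_j; last first.
  by move=> b /ub_gt ->; rewrite mulmx0.
rewrite -[in X in _ -> X](@submxcolK _ j (fun=> w) _ z) sqn_mxcol mul_mxrow_mxcol.
have -> : \sum_(a < j) sqn (ub (below a)) = \sum_a sqn (@submxcol R j (fun=> w) 1 z a).
  by apply: eq_bigr => a _; rewrite ub_lt.
have -> // : \sum_(a < j) blkcol X (below a) *m ub (below a)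
  = \sum_(a < j) blkcol X (below a) *m @submxcol R j (fun=> w) 1 z a.
by apply: eq_bigr => a _; rewrite ub_lt.
Qed.

End Blocks.

(** * Induction over the block columns *)

Section Columns.
Variables (R : realType) (I : Type) (F : set_system I).
Context {FF : Filter F}.
Local Notation "\dom_ i f <~ g" := (dom F (fun i => f) (fun i => g))
  (at level 70, i name, f at level 69, g at level 69).

Lemma dom_sum (J : finType) (f : J -> I -> R) g :
  (forall b, dom F (f b) g) -> \dom_ i \sum_b f b i <~ g i.
Proof.
move=> h; rewrite [X in dom F X](_ : _ = (fun i => \sum_(b <- enum J) f b i)); last first.
  by apply/funext => i; rewrite big_enum.
elim: (enum J) => [|b l IH].
  by exists 0 => //; near=> i; rewrite big_nil mul0r.
by apply: (dom_eq (domD (h b) IH)) => i; rewrite big_cons.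
Unshelve. all: by end_near. Qed.

Lemma dom_mxsub m n m' n' (f : 'I_m' -> 'I_m) (g : 'I_n' -> 'I_n)
    (A : I -> 'M[R]_(m, n)) h :
  dom F (fun i => onorm (A i)) h -> \dom_ i onorm (mxsub f g (A i)) <~ h i.
Proof.
move=> hA; apply: (domW (domZ (c := (m' * n')%:R) _ hA)) => //.
  by near=> i; exact: onorm_mxsub.
by near=> i.
Unshelve. all: by end_near. Qed.

Lemma dom_mxrow m p (q_ : 'I_p -> nat) (B : I -> forall b, 'M[R]_(m, q_ b)) h :
  (forall b, \dom_ i onorm (B i b) <~ h i) -> \dom_ i onorm (\mxrow_b B i b) <~ h i.
Proof.
move=> hB; have h1 := dom_sum hB.
apply: (domW (domZ (c := (m * (\sum_b q_ b))%:R) _ h1)) => //.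
  by near=> i; exact: onorm_mxrow.
by near=> i.
Unshelve. all: by end_near. Qed.

Lemma dom_mxcol n p (q_ : 'I_p -> nat) (B : I -> forall b, 'M[R]_(q_ b, n)) h :
  (forall b, \dom_ i onorm (B i b) <~ h i) -> \dom_ i onorm (\mxcol_b B i b) <~ h i.
Proof.
move=> hB; apply: (dom_eq (dom_mxT (dom_mxrow (B := fun i b => (B i b)^T) _))).
  by move=> b; apply: dom_mxT.
by move=> i; rewrite tr_mxrow; congr onorm; apply: eq_mxcol => b; rewrite trmxK.
Qed.

Variables (e s k : I -> R).
Hypotheses (e0 : forall i, 0 <= e i) (s0 : forall i, 0 < s i) (k1 : forall i, 1 <= k i).
Hypothesis small : forall c, 0 < c -> \forall i \near F, e i * k i ^+ 3 <= c.
Variables (m w p : nat) (X Q : I -> 'M[R]_(m, blockcols p w))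
  (T : I -> 'M[R]_(blockcols p w)).
Hypothesis gain : forall i y, s i ^+ 2 * sqn y <= sqn (X i *m y).
Hypothesis dX : \dom_ i onorm (X i) <~ k i * s i.

Let res i j := \sum_a blkcol (Q i) a *m blk (T i) a j - blkcol (X i) j.
Let ort i a b := (a == b)%:R%:M - (blkcol (Q i) a)^T *m blkcol (Q i) b.

Lemma residual_blocks : (forall j, \dom_ i onorm (res i j) <~ e i * (k i * s i)) ->
  \dom_ i onorm (Q i *m T i - X i) <~ e i * (k i * s i).
Proof.
move=> h; apply: (dom_eq (dom_mxrow h)) => i; congr onorm.
by rewrite mulmx_blocks -{1}(submxrowK (X i)) -mxrowB.
Qed.

Lemma orth_blocks : (forall a b, \dom_ i onorm (ort i a b) <~ e i * k i ^+ 2) ->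
  \dom_ i onorm (1%:M - (Q i)^T *m Q i) <~ e i * k i ^+ 2.
Proof.
move=> h; apply: (dom_eq (dom_mxrow (fun b => dom_mxcol (h^~ b)))) => i; congr onorm.
by rewrite -gram_blocks submxrowK.
Qed.

Hypothesis T_trig : forall i (a b : 'I_p), (b < a)%N -> blk (T i) a b = 0.
Hypothesis first : forall j : 'I_p, val j = 0%N ->
  \dom_ i onorm (blkcol (Q i) j *m blk (T i) j j - blkcol (X i) j) <~ e i * (k i * s i) /\
  \dom_ i onorm (1%:M - (blkcol (Q i) j)^T *m blkcol (Q i) j) <~ e i * k i ^+ 2.
Hypothesis step : forall i (j : 'I_p), (0 < j)%N ->
  bcgsia2s_step (e i) (\mxrow_(a < j) blkcol (Q i) (below a)) (blkcol (X i) j)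
    (blkcol (Q i) j) (\mxcol_(a < j) blk (T i) (below a) j) (blk (T i) j j).

Let res_sum i (j : 'I_p) : res i j =
  \sum_(a < j) blkcol (Q i) (below a) *m blk (T i) (below a) j
    + blkcol (Q i) j *m blk (T i) j j - blkcol (X i) j.
Proof.
rewrite /res (@sum_below _ _ (fun a => blkcol (Q i) a *m blk (T i) a j) j) //.
by move=> a ja; rewrite T_trig ?mulmx0.
Qed.

Let ort_tr i a b : (ort i a b)^T = ort i b a.
Proof.
by rewrite /ort linearB /= tr_scalar_mx trmx_mul trmxK eq_sym.
Qed.

(** Strong induction on [j]. Only blocks on and above the diagonal are treated, the others being
    their transposes. *)
Lemma column_errors (j : 'I_p) : \dom_ i onorm (res i j) <~ e i * (k i * s i) /\
  forall a : 'I_p, (a <= j)%N -> \dom_ i onorm (ort i a j) <~ e i * k i ^+ 2.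
Proof.
have [n] := ubnP (val j); elim: n => // n IHn in j * => /ltnSE jn.
have IH (b : 'I_p) : (b < j)%N -> \dom_ i onorm (res i b) <~ e i * (k i * s i) /\
    forall a : 'I_p, (a <= b)%N -> \dom_ i onorm (ort i a b) <~ e i * k i ^+ 2.
  by move=> bj; apply: IHn; exact: leq_trans jn.
have [j0|j_gt0] := posnP (val j).
  have [h1 h2] := first j0; split.
    apply: (dom_eq h1) => i; rewrite res_sum big1 ?add0r // => -[a aj].
    by exfalso; move: aj; rewrite j0.
  move=> a aj; have -> : a = j by apply/val_inj/eqP; rewrite j0 -leqn0 -[X in (_ <= X)%N]j0.
  by apply: (dom_eq h2) => i; rewrite /ort eqxx.
have IHort (a b : 'I_p) : (a < j)%N -> (b < j)%N -> \dom_ i onorm (ort i a b) <~ e i * k i ^+ 2.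
  move=> aj bj; have [ab|/ltnW ba] := leqP a b; first by have [_] := IH b bj; apply.
  have [_ /(_ b ba)/dom_mxT h] := IH a aj.
  by apply: (dom_eq h) => i; rewrite ort_tr.
pose Qp i := \mxrow_(a < j) blkcol (Q i) (below a).
pose Xp i := \mxrow_(a < j) blkcol (X i) (below a).
pose Tp i := \mxblock_(a < j, b < j) blk (T i) (below a) (below b).
have gainp i z y : s i ^+ 2 * (sqn z + sqn y) <= sqn (Xp i *m z + blkcol (X i) j *m y).
  exact: gain_prefix.
have dXj : \dom_ i onorm (blkcol (X i) j) <~ k i * s i by exact: dom_mxsub.
have dRes : \dom_ i onorm (Qp i *m Tp i - Xp i) <~ e i * (k i * s i).
  apply: (dom_eq (dom_mxrow (fun b : 'I_j => (IH (below b) (ltn_ord b)).1))) => i.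
  congr onorm; rewrite /Qp /Tp /Xp mul_mxrow_mxblock -mxrowB; apply: eq_mxrow => b.
  rewrite /res; congr (_ - _).
  (* The sum is cut at [j] rather than [b], so that all columns of [Tp] have the same height; the
     extra term is zero. *)
  rewrite (@sum_below _ _ (fun a => blkcol (Q i) a *m blk (T i) a (below b)) j); last first.
    by move=> a ja; rewrite T_trig ?mulmx0 // (ltn_trans (ltn_ord b)).
  by rewrite (T_trig i (ltn_ord b : below b < j)%N) mulmx0 addr0.
have dOrt : \dom_ i onorm (1%:M - (Qp i)^T *m Qp i) <~ e i * k i ^+ 2.
  have h (b a : 'I_j) := IHort (below a) (below b) (ltn_ord a) (ltn_ord b).
  apply: (dom_eq (dom_mxrow (fun b => dom_mxcol (h b)))) => i; congr onorm.
  rewrite gram_blocks; apply: eq_mxrow => b; apply: eq_mxcol => a.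
  by rewrite /ort -val_eqE.
(* The intermediate matrices exist run by run; choice makes them functions of the run, as domination
   requires. *)
case: (choice (fun i => step i j_gt0)) => S.
move=> /choice[V] /choice[Y] /choice[Om] /choice[D] /choice[W hstep].
have hS i : fl_mulmx (e i) (Qp i)^T (blkcol (X i) j) (S i) by have [] := hstep i.
have hV i : fl_submulmx (e i) (blkcol (X i) j) (Qp i) (S i) (V i) by have [] := hstep i.
have hY i : fl_mulmx (e i) (row_mx (Qp i) (V i))^T (V i) (col_mx (Y i) (Om i)).
  by have [] := hstep i.
have hD i : fl_submulmx (e i) (Om i) (Y i)^T (Y i) (D i) by have [] := hstep i.
have hT i : fl_chol (e i) (D i) (blk (T i) j j) by have [_ _ _ _ []] := hstep i.
have hW i : fl_submulmx (e i) (V i) (Qp i) (Y i) (W i) by have [_ _ _ _ []] := hstep i.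
have hQ i : fl_trsolve (e i) (W i) (blk (T i) j j) (blkcol (Q i) j).
  by have [_ _ _ _ []] := hstep i.
have hR i : fl_addmx (e i) (S i) (Y i) (\mxcol_(a < j) blk (T i) (below a) j).
  by have [_ _ _ _ []] := hstep i.
have r1 := step_residual e0 s0 k1 small gainp dXj dRes dOrt hS hV hY hD hT hW hQ hR.
have r2 := step_cross e0 s0 k1 small gainp dXj dRes dOrt hS hV hY hD hT hW hQ.
have r3 := step_orth e0 s0 k1 small gainp dXj dRes dOrt hS hV hY hD hT hW hQ.
split=> [|a].
  by apply: (dom_eq (r1 FF)) => i; rewrite res_sum mul_mxrow_mxcol.
rewrite leq_eqVlt => /orP[/eqP/val_inj ->|aj].
  by apply: (dom_eq (r3 FF)) => i; rewrite /ort eqxx.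
(* Off the diagonal, a block of [I - Q^T Q] is minus a block of [Qp^T *m Q]. *)
have r4 := dom_mxsub (tagnat.Rank (Ordinal aj)) id (r2 FF).
apply: (dom_eq (dom_mxN r4)) => i; congr onorm.
rewrite /Qp tr_mxrow mxcol_mul -[mxsub _ _ _]/(submxcol _ _) mxcolK /ort.
rewrite -val_eqE /= ltn_eqF // raddf0 sub0r; congr (- ((blkcol _ _)^T *m _)).
exact/val_inj.
Qed.

Lemma factorization_errors :
  \dom_ i onorm (Q i *m T i - X i) <~ e i * (k i * s i) /\
  \dom_ i onorm (1%:M - (Q i)^T *m Q i) <~ e i * k i ^+ 2.
Proof.
split; first by apply: residual_blocks => j; have [] := column_errors j.
apply: orth_blocks => a b; have [ab|/ltnW ba] := leqP a b.
  by have [_] := column_errors b; apply.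
have [_ /(_ b ba)/dom_mxT h] := column_errors a.
by apply: (dom_eq h) => i; rewrite ort_tr.
Qed.

End Columns.

(** Padding [y] by zeros shows that the gains of a block column lie between those of [X]. *)
Lemma blkcol_mulmx (R : realType) m w p (X : 'M[R]_(m, blockcols p w)) (j : 'I_p)
    (y : 'cV[R]_w) :
  exists2 u, X *m u = blkcol X j *m y & sqn u = sqn y.
Proof.
exists (\mxcol_b (if b == j then y else 0)).
  rewrite -{1}(submxrowK X) mul_mxrow_mxcol (bigD1 j) //= eqxx big1 ?addr0 //.
  by move=> b /negbTE ->; rewrite mulmx0.
rewrite sqn_mxcol (bigD1 j) //= eqxx big1 ?addr0 // => b /negbTE ->.
by rewrite /sqn big1 // => i _; rewrite mxE expr0n.
Qed.

(* The O-constants must not depend on the data; this is expressed by letting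
   every quantity be a function of the run, and [e * kappa ^ 3] tend to 0. *)
Record bcgs_run (R : realType) (m w p : nat) (c1 c2 : R) := BcgsRun {
  run_e : R;
  run_alpha : R;
  run_IO : 'M[R]_(m, w) -> 'M[R]_(m, w) * 'M[R]_w;
  run_X : 'M[R]_(m, blockcols p w);
  run_Q : 'M[R]_(m, blockcols p w);
  run_T : 'M[R]_(blockcols p w);
  run_e_gt0 : 0 < run_e;
  run_alpha_ge0 : 0 <= run_alpha;
  run_alpha_le2 : run_alpha <= 2;
  run_kappa_fin : kappa run_X != +oo%E;
  run_accurate : io_accurate run_e c1 c2 run_alpha run_IO (kappa run_X);
  run_bcgs : bcgsia2s run_e run_IO run_X run_Q run_T }.

(** * Uniform bounds over all runs *)

Section Runs.
Variables (R : realType) (m w p : nat) (c1 c2 : R).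
Hypothesis w_gt0 : (0 < w)%N.
Let run := bcgs_run m w p c1 c2.
Variables (s k : run -> R).
Hypothesis kE : forall i : run, kappa (run_X i) = (k i)%:E.
Hypotheses (s0 : forall i, 0 < s i) (k1 : forall i, 1 <= k i).
Hypothesis lo : forall i y, s i ^+ 2 * sqn y <= sqn (run_X i *m y).
Hypothesis hi : forall i y, sqn (run_X i *m y) <= (k i * s i) ^+ 2 * sqn y.

(** A property holds near [F] when it holds for all runs with [e * k ^+ 3] below some positive
    threshold, so constants found along [F] depend on no single run. *)
Let F : set_system run :=
  filter_from [set d : R | 0 < d]%classic
    (fun d => [set i | run_e i * k i ^+ 3 <= d]%classic).

#[local] Instance run_filter : Filter F.
Proof.
apply: filter_from_filter; first by exists 1; rewrite /= ltr01.
move=> a b a0 b0; exists (Num.min a b); first by rewrite /= lt_min a0.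
by move=> i /=; rewrite le_min => /andP[].
Qed.

Let small c : 0 < c -> \forall i \near F, run_e i * k i ^+ 3 <= c.
Proof. by exists c. Qed.

Let ks0 i : 0 <= k i * s i.
Proof. by rewrite mulr_ge0 ?(ltW (s0 i)) // (le_trans ler01). Qed.

Let dX : dom F (fun i => onorm (run_X i)) (fun i => k i * s i).
Proof.
exists (m * blockcols p w)%:R => //.
by apply: nearW => i; apply: onorm_le_gain.
Qed.

(** The lower bound on [k'] makes its powers monotone in the exponent. *)
Let first_block (i : run) (j : 'I_p) :
  exists2 k' : R, kappa (blkcol (run_X i) j) = k'%:E & 1 <= k' <= k i.
Proof.
have h : (kappa (blkcol (run_X i) j) <= (k i)%:E)%E.
  apply: (kappa_le w_gt0 (s0 i)) => [|y|y]; first by rewrite (le_trans ler01).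
    by have [u <- <-] := blkcol_mulmx (run_X i) j y.
  by have [u <- <-] := blkcol_mulmx (run_X i) j y.
have [|s' [k' [E _ k'1 _ _]]] := kappa_fin w_gt0 (A := blkcol (run_X i) j).
  by apply/eqP => E; rewrite E in h.
by exists k' => //; rewrite k'1 -lee_fin -E.
Qed.

Let first (j : 'I_p) : val j = 0%N ->
  dom F (fun i => onorm (blkcol (run_Q i) j *m blk (run_T i) j j - blkcol (run_X i) j))
    (fun i => run_e i * (k i * s i)) /\
  dom F (fun i => onorm (1%:M - (blkcol (run_Q i) j)^T *m blkcol (run_Q i) j))
    (fun i => run_e i * k i ^+ 2).
Proof.
move=> j0; split.
  (* The sign of [c1] is unspecified, hence the absolute value. *)
  have c0 : 0 <= (m * w)%:R * `|c1| by rewrite mulr_ge0.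
  have hX : dom F (fun i => onorm (blkcol (run_X i) j)) (fun i => k i * s i).
    exact: dom_mxsub.
  apply: (domW (domM _ _ (domZ c0 (dom_refl (@run_e _ _ _ _ _ _))) hX)).
  - by move=> i; rewrite mulr_ge0 // ltW // run_e_gt0.
  - by move=> i; exact: onorm_ge0.
  - apply: nearW => i; have [IO1 _ _] := run_bcgs i.
    have [k' kE' /andP[_ k'k]] := first_block i j.
    have /run_accurate [[dX1]] : (kappa (blkcol (run_X i) j) <= kappa (run_X i))%E.
      by rewrite kE kE' lee_fin.
    rewrite IO1 //= => E hdX _; rewrite -E addrC addKr.
    apply: (le_trans (onorm_le_mxnorm2 _)); rewrite -!mulrA ler_wpM2l //.
    apply: (le_trans hdX); rewrite -mulrA.
    apply: (@le_trans _ _ (`|c1| * (run_e i * mxnorm2 (blkcol (run_X i) j)))).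
      by rewrite ler_wpM2r ?ler_norm // mulr_ge0 ?mxnorm2_ge0 // ltW // run_e_gt0.
    rewrite !ler_wpM2l ?mxnorm2_le_onorm // ltW //; exact: run_e_gt0.
  - by apply: nearW.
exists ((w * w)%:R * `|c2|); first by rewrite mulr_ge0.
apply: nearW => i; have [IO1 _ _] := run_bcgs i.
have [k' kE' /andP[k'1 k'k]] := first_block i j.
have /run_accurate [_] : (kappa (blkcol (run_X i) j) <= kappa (run_X i))%E.
  by rewrite kE kE' lee_fin.
rewrite IO1 //= kE' poweR_EFin -EFinM lee_fin => h.
apply: (le_trans (onorm_le_mxnorm2 _)); rewrite -!mulrA ler_wpM2l //.
apply: (le_trans h); rewrite -mulrA.
have e0 := ltW (run_e_gt0 i).
apply: (@le_trans _ _ (`|c2| * (run_e i * k' `^ run_alpha i))).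
  by rewrite ler_wpM2r ?ler_norm // mulr_ge0 // powR_ge0.
(* Here [alpha <= 2] enters: the power of [k'] is at most [k' ^ 2], hence at most [k ^ 2]. *)
rewrite !ler_wpM2l //; apply: (@le_trans _ _ (k' `^ 2)).
  by apply: ler_powR => //; exact: run_alpha_le2.
have k'0 : 0 <= k' by rewrite (le_trans ler01).
by rewrite powR_mulrn // lerXn2r ?nnegrE // (le_trans k'0).
Qed.

Lemma run_errors : exists2 d : R, 0 < d & exists c4 c5 : R,
  [/\ 0 <= c4, 0 <= c5 & forall i : run, run_e i * k i ^+ 3 <= d ->
    onorm (run_Q i *m run_T i - run_X i) <= c4 * (run_e i * (k i * s i)) /\
    onorm (1%:M - (run_Q i)^T *m run_Q i) <= c5 * (run_e i * k i ^+ 2)].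
Proof.
have e0 (i : run) : 0 <= run_e i by rewrite ltW // run_e_gt0.
have T0 (i : run) (a b : 'I_p) : (b < a)%N -> blk (run_T i) a b = 0.
  by have [_ _] := run_bcgs i; apply.
have st (i : run) := let: And3 _ h _ := run_bcgs i in h.
have [[c4 c40 h4] [c5 c50 h5]] :=
  factorization_errors e0 s0 k1 small lo dX T0 first st.
(* Both bounds hold below a common threshold [d], which will fix the constant of the smallness
   hypothesis. *)
have [d d0 hd] := filterI h4 h5.
by exists d => //; exists c4, c5; split => // i /hd[].
Qed.

End Runs.

(** * Choice of the constants of the statement *)

Unset Implicit Arguments.

Theorem theorem4 (R : realType) (m s p : nat) (hm : (0 < m)%N)
    (hs : (0 < s)%N) (hp : (0 < p)%N) (hmps : (p * s <= m)%N)
    (c1 c2 : R) :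
  exists c3 c4 c5 : R, 0 < c3 /\
  forall (e : R) (he : 0 < e)
    (alpha : R) (halpha0 : 0 <= alpha)
    (IO : 'M[R]_(m, s) -> 'M[R]_(m, s) * 'M[R]_s)
    (X : 'M[R]_(m, blockcols p s)),
    io_accurate e c1 c2 alpha IO (kappa X) ->
    alpha <= 2 ->
    ((c3 * e)%:E * kappa X `^ 3 <= (2^-1)%:E)%E ->
    forall (Q : 'M[R]_(m, blockcols p s)) (T : 'M[R]_(blockcols p s)),
      bcgsia2s e IO X Q T ->
      (exists2 dX : 'M[R]_(m, blockcols p s), X + dX = Q *m T &
         mxnorm2 dX <= c4 * e * mxnorm2 X) /\
      ((mxnorm2 (1%:M - Q^T *m Q))%:E <= (c5 * e)%:E * kappa X `^ 2)%E.
Proof.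
have ps_gt0 : (0 < blockcols p s)%N by rewrite sum_nat_const card_ord muln_gt0 hp.
(* All runs are treated at once, so that the constants are obtained before any data are given. *)
case: (choice (fun i : bcgs_run m s p c1 c2 => kappa_fin ps_gt0 (run_kappa_fin i))).
move=> sg /choice[k hk].
have kE i : kappa (run_X i) = (k i)%:E by have [] := hk i.
have s0 i : 0 < sg i by have [] := hk i.
have k1 i : 1 <= k i by have [] := hk i.
have lo i y : sg i ^+ 2 * sqn y <= sqn (run_X i *m y) by have [_ _ _ _ []] := hk i.
have hi i y : sqn (run_X i *m y) <= (k i * sg i) ^+ 2 * sqn y.
  by have [_ _ _ _ []] := hk i.
have [d d0 [c4 [c5 [c40 c50 err]]]] := run_errors hs kE s0 k1 lo hi.
have d2 : 0 < 2 * d by rewrite mulr_gt0.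
(* With this first constant the hypothesis reads [e * kappa ^ 3 <= d]; the dimension factor in the
   second one passes from [onorm X] to the 2-norm. *)
exists (2 * d)^-1, (c4 * (m * blockcols p s)%:R), c5; split; first by rewrite invr_gt0.
move=> e he alpha ha0 IO X acc ha2 small Q T alg.
(* The coefficient [c3 * e] is positive, so an infinite condition number would make the left side of
   [small] infinite. *)
have kfin : kappa X != +oo%E.
  apply: contraTneq small => ->.
  rewrite poweRyr // gt0_muley ?lte_fin ?mulr_gt0 ?invr_gt0 //.
pose i := BcgsRun he ha0 ha2 kfin acc alg.
have kXE : kappa X = (k i)%:E := kE i.
have k0 : 0 <= k i by rewrite (le_trans ler01).
have eks : e * k i ^+ 3 <= d.
  move: small; rewrite kXE poweR_EFin powR_mulrn // -EFinM lee_fin -mulrA.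
  rewrite ler_pdivrMl //; lra.
have [h4 h5] := err i eks; split.
  exists (Q *m T - X); first by rewrite addrC subrK.
  apply: (le_trans (mxnorm2_le_onorm _)); apply: (le_trans h4).
  rewrite -!mulrA ler_wpM2l // [leRHS]mulrCA; apply: ler_wpM2l; first exact: ltW.
  have [_ _ _ h _] := hk i; apply: (le_trans h); exact: onorm_le_mxnorm2.
rewrite kXE poweR_EFin powR_mulrn // -EFinM lee_fin -mulrA.
exact: le_trans (mxnorm2_le_onorm _) h5.
Qed.
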